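(* Let $f:\mathbb{R}^2\to\mathbb{R}$ be a continuous function. Then $f$ is vertically rigid if and only if, after a suitable rotation around the $z$-axis, $f(x,y)$ is of one of the following forms: (i) $a+bx+dy$ with $a,b,d\in\mathbb{R}$; (ii) $a+s(y)e^{kx}$ with $a,k\in\mathbb{R}$, $k\neq 0$, and $s:\mathbb{R}\to\mathbb{R}$ continuous; (iii) $a+be^{kx}+dy$ with $a,b,d,k\in\mathbb{R}$, $k\neq 0$.
   Context: For $f:\mathbb{R}^2\to\mathbb{R}$ write $graph(f)=\{(x,y,f(x,y)):(x,y)\in\mathbb{R}^2\}\subset\mathbb{R}^3$. The function $f$ is called vertically rigid if for every $c\in(0,\infty)$ the set $graph(cf)$ is isometric to $graph(f)$, i.e. there is an isometry $\varphi$ of $\mathbb{R}^3$ (Euclidean metric, not necessarily orientation-preserving) with $\varphi(graph(f))=graph(cf)$. ''After a suitable rotation around the $z$-axis $f(x,y)$ is of a given form'' means that there is a rotation $\rho$ of $\mathbb{R}^2$ about the origin such that the function $f\circ\rho$ is of that form. *)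

(* Defs.v *)
From HB Require Import structures.
From mathcomp Require Import all_boot all_order all_algebra.
From mathcomp Require Import all_classical all_reals all_analysis.
Set Implicit Arguments.
Unset Strict Implicit.
Unset Printing Implicit Defensive.
Import Order.TTheory GRing.Theory Num.Theory.
Import numFieldNormedType.Exports.
Local Open Scope classical_set_scope.
Local Open Scope ring_scope.

(* The norm the library puts on products is the sup norm, so the Euclidean
   distance is written out. The topology on [R * R] is the usual one. *)
Definition euclidean_dist3 (R : realType) (p q : R * R * R) : R :=
  Num.sqrt ((p.1.1 - q.1.1) ^+ 2 + (p.1.2 - q.1.2) ^+ 2 + (p.2 - q.2) ^+ 2).

Definition isometry3 (R : realType) (phi : R * R * R -> R * R * R) : Prop :=
  bijective phi /\
  forall p q, euclidean_dist3 (phi p) (phi q) = euclidean_dist3 p q.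

Definition graph3 (R : realType) (f : R * R -> R) : set (R * R * R) :=
  [set (p, f p) | p in setT].

Definition vertically_rigid (R : realType) (f : R * R -> R) : Prop :=
  forall c : R, 0 < c ->
    exists phi : R * R * R -> R * R * R,
      isometry3 phi /\ phi @` graph3 f = graph3 (fun p => c * f p).

Definition rotation2 (R : realType) (theta : R) (p : R * R) : R * R :=
  (cos theta * p.1 - sin theta * p.2, sin theta * p.1 + cos theta * p.2).

Definition affine_form (R : realType) (g : R * R -> R) : Prop :=
  exists a b d : R, forall x y : R, g (x, y) = a + b * x + d * y.

Definition separated_exp_form (R : realType) (g : R * R -> R) : Prop :=
  exists (a k : R) (s : R -> R),
    [/\ k != 0, continuous s
      & forall x y : R, g (x, y) = a + s y * expR (k * x)].

Definition exp_plus_linear_form (R : realType) (g : R * R -> R) : Prop :=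
  exists a b d k : R,
    k != 0 /\ forall x y : R, g (x, y) = a + b * expR (k * x) + d * y.

(* Main.v *)
Require Import Defs.
From HB Require Import structures.
From mathcomp Require Import all_boot all_order all_algebra.
From mathcomp Require Import all_classical all_reals all_analysis.
From mathcomp Require Import ring lra.
Set Implicit Arguments.
Unset Strict Implicit.
Unset Printing Implicit Defensive.
Import Order.TTheory GRing.Theory Num.Theory.
Import numFieldNormedType.Exports.
Local Open Scope classical_set_scope.
Local Open Scope ring_scope.

(** The necessity of the three forms is proved with the slope cone [E] of [f]:
    the closed convex cone of the directions [(v, s)] such that no chord of the
    graph in the direction [v] has a slope larger than [s]. A direction with no
    chord lies in [E] or in [- E], because the slopes of the chords over a given
    direction form an interval ([chord_free_slope]). An isometry between graphs
    matches the chords, hence its linear part takes [E] to the slope cone of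
    [c * f], up to sign; the latter is the vertical dilation of [E] by [c]
    ([slope_cone_image], [slope_cone_dilate]). So [E] is isometric to all its
    vertical dilations.

    Suppose first that [E] contains no line. For small [c] the dilations would
    contain nearly opposite vectors if [E] had directions over both [v] and
    [- v], and for large [c] they would if [E] contained a direction below the
    horizontal; compactness forbids both ([pointed_cone_gap]). The dilations of [E]
    are then nested, and a linear isometry cannot map a closed cone to a proper
    subset of itself ([orth_stable_onto]), so they are all equal: [E] is a product
    [T * [0, +oo)] ([rigid_cone_flat]). The preimages of the vertical direction
    under the linear parts are extreme directions of [E], of which there are at
    most three. By the pigeonhole principle two of the isometries have the same
    preimage, and composing one with the inverse of the other gives a planar
    isometry [psi] with [f (psi p) = +- l * f p + d]; since positive numbers have
    roots of all orders, every [l] in [(0, 1)] occurs ([flat_cone_scales]).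

    Taking squares, [psi] may be assumed to preserve the orientation. It is not a
    rotation, because at its fixed point and on the discs around it the equation
    would force [f] to be constant; so it is a translation
    ([scales_by_translation]). The constants [d] come from a single one, hence
    some [h = f - a0] is multiplied by each [l] under a translation
    ([common_constant]). The translations that multiply [h] by a constant form a
    closed uncountable subgroup of the plane; it contains a line, along which [h]
    is an exponential ([exponential_line]). This is the separated form.

    If [E] contains a line then, after a rotation, [f] is [g x + m * y], and
    its graph is a cylinder over the graph of [g / Num.sqrt (1 + m ^+ 2)]
    ([cylinder_graph]). The rigidity of [f] says that this plane curve is isometric
    to its multiples, at least by the factors in [(0, 1]], and a variant of the
    argument, carried out in the vertical plane of the curve, shows that [g] is affine or
    exponential up to a constant ([rigid_curve]).

    Conversely, in the separated form multiplication by [c] is a translation. In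
    the third form the graphs of [f] and [c * f] are cylinders whose profiles differ
    by a translation ([exp_plus_linear_rigid]), and the affine functions are, up to
    rotation, degenerate cases of it. *)

(** * Linear isometries of space *)

Definition dot (R : realType) (p q : R * R * R) : R :=
  p.1.1 * q.1.1 + p.1.2 * q.1.2 + p.2 * q.2.

Definition sq (R : realType) (p : R * R * R) : R := dot p p.

Lemma dotC (R : realType) (p q : R * R * R) : dot p q = dot q p.
Proof. by rewrite /dot; ring. Qed.

Lemma dotDl (R : realType) (p q r : R * R * R) :
  dot (p + q) r = dot p r + dot q r.
Proof. by rewrite /dot /=; ring. Qed.

Lemma dotZl (R : realType) (a : R) (p q : R * R * R) :
  dot (a *: p) q = a * dot p q.
Proof. by rewrite /dot /= /GRing.scale /=; ring. Qed.

Lemma dotNl (R : realType) (p q : R * R * R) : dot (- p) q = - dot p q.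
Proof. by rewrite -scaleN1r dotZl mulN1r. Qed.

Lemma dotDr (R : realType) (p q r : R * R * R) :
  dot r (p + q) = dot r p + dot r q.
Proof. by rewrite dotC dotDl !(dotC r). Qed.

Lemma dotZr (R : realType) (a : R) (p q : R * R * R) :
  dot p (a *: q) = a * dot p q.
Proof. by rewrite dotC dotZl dotC. Qed.

Lemma dotNr (R : realType) (p q : R * R * R) : dot p (- q) = - dot p q.
Proof. by rewrite dotC dotNl dotC. Qed.

Definition dotE := (dotDl, dotDr, dotNl, dotNr, dotZl, dotZr).

Lemma sq_ge0 (R : realType) (p : R * R * R) : 0 <= sq p.
Proof. by rewrite /sq /dot -!expr2 !addr_ge0 ?sqr_ge0. Qed.

Lemma sq_eq0 (R : realType) (p : R * R * R) : sq p = 0 -> p = 0.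
Proof.
case: p => [[x y] z]; rewrite /sq /dot /= => h.
have hx : x = 0 by nra.
have hy : y = 0 by nra.
have hz : z = 0 by nra.
by rewrite hx hy hz.
Qed.

Lemma sqN (R : realType) (p : R * R * R) : sq (- p) = sq p.
Proof. by rewrite /sq !dotE opprK. Qed.

Lemma sqZ (R : realType) (a : R) (p : R * R * R) : sq (a *: p) = a ^+ 2 * sq p.
Proof. by rewrite /sq !dotE expr2 mulrA. Qed.

Lemma sqBC (R : realType) (p q : R * R * R) : sq (p - q) = sq (q - p).
Proof. by rewrite -sqN opprB. Qed.

(** The parallelogram law; it replaces the triangle inequality below. *)
Lemma sqD_le (R : realType) (p q : R * R * R) :
  sq (p + q) <= 2 * sq p + 2 * sq q.
Proof.
have := sq_ge0 (p - q); rewrite /sq !dotE (dotC q p); lra.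
Qed.

Lemma sqB_le (R : realType) (p q r : R * R * R) :
  sq (p - r) <= 2 * sq (p - q) + 2 * sq (q - r).
Proof. by have := sqD_le (p - q) (q - r); rewrite addrA subrK. Qed.

(** [B] is the inverse of [A]; carrying it along makes the notion symmetric. *)
Definition linear_isometry (R : realType) (A B : R * R * R -> R * R * R) : Prop :=
  [/\ forall a p q, A (a *: p + q) = a *: A p + A q,
      forall p q, dot (A p) (A q) = dot p q, cancel A B & cancel B A].

Section LinearIsometry.
Context (R : realType) (A B : R * R * R -> R * R * R).
Hypothesis AB : linear_isometry A B.

Lemma orth_dot p q : dot (A p) (A q) = dot p q. Proof. by case: AB. Qed.
Lemma orthK : cancel A B. Proof. by case: AB. Qed.
Lemma orthVK : cancel B A. Proof. by case: AB. Qed.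
Lemma orthD p q : A (p + q) = A p + A q.
Proof. by case: AB => /(_ 1 p q); rewrite !scale1r. Qed.
Lemma orth0 : A 0 = 0.
Proof. by apply: (@addrI _ (A 0)); rewrite -orthD !addr0. Qed.
Lemma orthZ a p : A (a *: p) = a *: A p.
Proof. by case: AB => /(_ a p 0); rewrite !addr0 orth0 addr0. Qed.
Lemma orthN p : A (- p) = - A p.
Proof. by rewrite -scaleN1r orthZ scaleN1r. Qed.
Lemma orthB p q : A (p - q) = A p - A q.
Proof. by rewrite orthD orthN. Qed.
Lemma orth_sq p : sq (A p) = sq p. Proof. exact: orth_dot. Qed.

Lemma orth_sym : linear_isometry B A.
Proof.
split; [|by move=> p q; rewrite -orth_dot !orthVK|exact: orthVK|exact: orthK].
by move=> a p q; rewrite -[RHS]orthK orthD orthZ !orthVK.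
Qed.

Lemma linear_isometry_opp : linear_isometry (fun p => - A p) (fun p => - B p).
Proof.
split=> [a p q|p q|p|p].
- by rewrite orthD orthZ opprD scalerN.
- by rewrite !dotE opprK orth_dot.
- by rewrite (_ : B (- A p) = - p) ?opprK// -orthN orthK.
- by rewrite orthN orthVK opprK.
Qed.

End LinearIsometry.

Lemma orth_comp (R : realType) (A B A' B' : R * R * R -> R * R * R) :
  linear_isometry A B -> linear_isometry A' B' -> linear_isometry (A' \o A) (B \o B').
Proof.
move=> AB AB'; split=> [a p q|p q|p|p] /=.
- by rewrite (orthD AB) (orthZ AB) (orthD AB') (orthZ AB').
- by rewrite (orth_dot AB') (orth_dot AB).
- by rewrite (orthK AB') (orthK AB).
- by rewrite (orthVK AB) (orthVK AB').
Qed.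

Lemma dist3_sq (R : realType) (p q p' q' : R * R * R) :
  (euclidean_dist3 p q = euclidean_dist3 p' q') <-> (sq (p - q) = sq (p' - q')).
Proof.
have dE (u v : R * R * R) : euclidean_dist3 u v = Num.sqrt (sq (u - v)).
  by rewrite /euclidean_dist3 /sq /dot -!expr2.
rewrite !dE; split=> [|-> //] /(congr1 (fun x => x ^+ 2)).
by rewrite !sqr_sqrtr ?sq_ge0.
Qed.

(** Distances determine inner products by polarization, and inner products
    determine the linear structure: the square of the defect of linearity
    expands into inner products. *)
Lemma isometry3_affine (R : realType) (phi : R * R * R -> R * R * R) :
  isometry3 phi ->
  exists A B, linear_isometry A B /\ forall p, phi p = A p + phi 0.
Proof.
move=> [[psi phiK psiK] iso].
pose A p := phi p - phi 0; pose B p := psi (p + phi 0).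
have phiE p : phi p = A p + phi 0 by rewrite /A subrK.
have A0 : A 0 = 0 by rewrite /A subrr.
have AsqB p q : sq (A p - A q) = sq (p - q).
  have /dist3_sq := iso p q.
  by rewrite /A opprB addrA subrK.
have BK : cancel A B by move=> p; rewrite /B /A subrK phiK.
have AK : cancel B A by move=> p; rewrite /B /A psiK addrK.
clearbody A B.
have Asq p : sq (A p) = sq p by have := AsqB p 0; rewrite A0 !subr0.
have Adot p q : dot (A p) (A q) = dot p q.
  have := AsqB p q; have := Asq p; have := Asq q.
  rewrite /sq !dotE (dotC (A q) (A p)) (dotC q p); lra.
exists A, B; split => //; split => // a p q.
apply/eqP; rewrite -subr_eq0; apply/eqP/sq_eq0.
by rewrite /sq !dotE !Adot !dotE (dotC p q); ring.
Qed.

(** * Closed sets and linear isometries *)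

Lemma sq_ball (R : realType) (x y : R * R * R) (e : R) : 0 < e ->
  sq (x - y) < e ^+ 2 -> ball x e y.
Proof.
case: x y => [[x1 x2] x3] [[y1 y2] y3] e0; rewrite /sq /dot /= => h.
have abs_lt a : a * a < e ^+ 2 -> `|a| < e.
  by rewrite -expr2 -real_normK ?num_real// ltr_pXn2r// ?nnegrE// ltW.
have := sqr_ge0 (x1 - y1); have := sqr_ge0 (x2 - y2).
have := sqr_ge0 (x3 - y3); rewrite ![(_ - _) ^+ 2]expr2 => h3 h2 h1.
by split; [split|]; rewrite /ball /=; apply: abs_lt; lra.
Qed.

Lemma ball_sq (R : realType) (x y : R * R * R) (e : R) : 0 < e ->
  ball x e y -> sq (x - y) < 3 * e ^+ 2.
Proof.
case: x y => [[x1 x2] x3] [[y1 y2] y3] e0 [[]].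
rewrite /ball /= => h1 h2 h3; rewrite /sq /dot /=.
have abs_lt a : `|a| < e -> a * a < e ^+ 2.
  by move=> h; rewrite -expr2 -(@real_normK _ a) ?num_real// ltr_pXn2r// ?nnegrE// ltW.
by have := abs_lt _ h1; have := abs_lt _ h2; have := abs_lt _ h3; lra.
Qed.

Lemma closed_sq (R : realType) (S : set (R * R * R)) (x : R * R * R) :
  closed S -> (forall e, 0 < e -> exists2 y, S y & sq (x - y) < e) -> S x.
Proof.
move=> clS near_x; apply: clS => U /nbhs_ballP [e /= e0 eU].
have [y Sy xy] := near_x (e ^+ 2) (exprn_gt0 _ e0).
by exists y; split => //; apply/eU/sq_ball.
Qed.

(** Bolzano--Weierstrass, in the form of a cluster point. *)
Lemma bounded_cluster (R : realType) (u : nat -> R * R * R) (C : R) :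
  (forall n, sq (u n) <= C) ->
  exists y, forall e, 0 < e -> forall n, exists2 m, (n <= m)%N & sq (u m - y) < e.
Proof.
move=> uC; pose I := [set` `[- (C + 1), C + 1] ].
have cK : compact (I `*` I `*` I).
  by apply: compact_setX; [apply: compact_setX|]; exact: segment_compact.
have uK n : (I `*` I `*` I) (u n).
  have := uC n; case: (u n) => [[a b] c]; rewrite /sq /dot /= => h.
  by split; [split|]; rewrite /I /= in_itv /=; apply/andP; split; nra.
have [|y [_ cly]] := cK (u @ \oo) _; first by exists 0%N => // n _ /=; exact: uK.
exists y => e e0 n.
have r0 : 0 < Num.sqrt (e / 3) by rewrite sqrtr_gt0 divr_gt0.
have [|z [[m nm umz] yz]] := cly [set z | exists2 m, (n <= m)%N & u m = z]
   (ball y (Num.sqrt (e / 3))) _ (nbhsx_ballx _ _ r0).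
  by exists n => // m nm /=; exists m.
exists m => //; rewrite umz sqBC; apply: lt_le_trans (ball_sq r0 yz) _.
by rewrite sqr_sqrtr; lra.
Qed.

(** A linear isometry is recurrent: the orbit of [x] returns close to itself,
    hence to [x]. So a closed set mapped into itself is mapped onto itself. *)
Lemma orth_stable_onto (R : realType) (A B : R * R * R -> R * R * R)
    (E : set (R * R * R)) :
  linear_isometry A B -> closed E -> (forall x, E x -> E (A x)) ->
  forall x, E x -> E (B x).
Proof.
move=> AB clE EA x Ex.
have itE n : E (iter n A x) by elim: n => //= n /EA.
have itsq n p q : sq (iter n A p - iter n A q) = sq (p - q).
  by elim: n => //= n <-; rewrite -(orthB AB) (orth_sq AB).
have it0 n : sq (iter n A x) <= sq x.
  by elim: n => //= n; rewrite (orth_sq AB).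
have [y cly] := bounded_cluster it0.
apply: closed_sq clE _ => e e0; have e4 : 0 < e / 4 by lra.
have [n _ ny] := cly _ e4 0%N.
have [m nm my] := cly _ e4 n.+1.
(* The iterates [n < m] of [x] are close, so [x] is close to its iterate of
   order [m - n], and [B x] to the one of order [m - n - 1]. *)
exists (iter (m - n.+1) A x) => //.
rewrite -(orth_sq AB) (orthB AB) (orthVK AB) -iterS -subSn// subSS.
rewrite -(itsq n) -iterD subnKC 1?ltnW//.
apply: le_lt_trans (sqB_le _ y _) _.
by rewrite [X in _ + 2 * X]sqBC; lra.
Qed.

(** Such a cone is the epigraph of a lower semicontinuous sublinear function [M]
    on the plane, with values in the extended reals, such that
    [M v + M (- v) > 0] for all [v != 0]. *)
Definition pointed_cone (R : realType) (E : set (R * R * R)) : Prop :=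
  [/\ closed E, forall x y, E x -> E y -> E (x + y),
      forall t x, 0 <= t -> E x -> E (t *: x), E (0, 0, 1)
    & forall x, E x -> E (- x) -> x = 0].

(** For [c > 0] this is the image of [E] under the vertical dilation by [c],
    written as a preimage so that membership computes. *)
Definition vdilate (R : realType) (c : R) (E : set (R * R * R)) :
    set (R * R * R) :=
  [set x | E (x.1, c^-1 * x.2)].

(** In a closed pointed cone two vectors cannot be almost opposite, by
    compactness of the set of its unit vectors. *)
Lemma pointed_cone_gap (R : realType) (E : set (R * R * R)) :
  pointed_cone E ->
  exists2 d : R, 0 < d & forall x y, E x -> E y -> d * sq x <= sq (x + y).
Proof.
move=> [clE _ EZ _ Ept]; apply: contrapT => nogap.
have bad n : exists xy, [/\ E xy.1, E xy.2, sq xy.1 = 1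
    & sq (xy.1 + xy.2) < (n.+1%:R^-1 : R)].
  apply: contrapT => nobad; apply: nogap; exists n.+1%:R^-1; first by rewrite invr_gt0.
  move=> x y Ex Ey; rewrite leNgt; apply/negP => lt_xy; apply: nobad.
  have x0 : 0 < sq x.
    rewrite lt_def sq_ge0 andbT; apply/eqP => x0; move: lt_xy.
    by rewrite x0 mulr0 ltNge sq_ge0.
  pose k := (Num.sqrt (sq x))^-1.
  have k0 : 0 <= k by rewrite invr_ge0 sqrtr_ge0.
  have k2 : k ^+ 2 * sq x = 1 by rewrite exprVn sqr_sqrtr ?sq_ge0// mulVf// gt_eqF.
  exists (k *: x, k *: y); split => /=; [exact: EZ|exact: EZ|by rewrite sqZ|].
  have k20 : 0 < k ^+ 2 by rewrite exprVn invr_gt0 exprn_gt0// sqrtr_gt0.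
  rewrite -scalerDr sqZ; apply: lt_le_trans (_ : k ^+ 2 * (n.+1%:R^-1 * sq x) <= _).
    by rewrite ltr_pM2l.
  by rewrite mulrCA k2 mulr1.
have [xy xyP] := choice bad.
have [|y cly] := @bounded_cluster R (fun n => (xy n).1) 1.
  by move=> n; have [_ _ ->] := xyP n.
have y1 : sq y != 0.
  apply/eqP => /sq_eq0 y0.
  have [m _] := cly 1 ltr01 0%N; have [_ _ + _] := xyP m.
  by rewrite y0 subr0 => ->; rewrite ltxx.
have Ey : E y.
  apply: closed_sq clE _ => e e0; have [m _ my] := cly e e0 0%N.
  by exists (xy m).1; [have [] := xyP m|rewrite sqBC].
suff ENy : E (- y) by move/eqP: y1; apply; rewrite (Ept _ Ey ENy) /sq /dot /= !mulr0 !addr0.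
apply: closed_sq clE _ => e e0.
have e4 : 0 < e / 4 by lra.
have [N Ne] : exists N : nat, (N.+1%:R^-1 : R) < e / 4.
  by have := near_infty_natSinv_lt (PosNum e4); case=> N _ /(_ N (leqnn N)) /=; exists N.
have [m Nm my] := cly _ e4 N.
exists (xy m).2; first by have [] := xyP m.
have [_ _ _ xym] := xyP m.
rewrite -sqN opprB opprK.
have -> : (xy m).2 + y = ((xy m).1 + (xy m).2) - ((xy m).1 - y).
  by rewrite opprB [RHS]addrC addrA subrK addrC.
apply: le_lt_trans (sqD_le _ _) _; rewrite sqN.
have : sq ((xy m).1 + (xy m).2) < e / 4; last by lra.
apply: lt_trans xym (le_lt_trans _ Ne).
by rewrite lef_pV2 ?posrE// ler_nat ltnS.
Qed.

(** * The slope cone of a function *)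

(** The recession cone of the epigraph of [f]: moving the graph along one of its
    directions never brings a point below the graph. *)
Definition slope_cone (R : realType) (f : R * R -> R) : set (R * R * R) :=
  [set w | forall p t, 0 <= t -> f (p + t *: w.1) <= f p + t * w.2].

Lemma slope_cone_closed (R : realType) (f : R * R -> R) :
  continuous f -> closed (slope_cone f).
Proof.
move=> fc.
have -> : slope_cone f =
    \bigcap_(pt in [set pt : (R * R) * R | 0 <= pt.2])
      [set w | f (pt.1 + pt.2 *: w.1) <= f pt.1 + pt.2 * w.2].
  by apply/seteqP; split=> w wE => [[p t] /= t0|p t t0]; [exact: wE|exact: (wE (p, t))].
apply: closed_bigI => -[p t] _ /=.
have -> : [set w : R * R * R | f (p + t *: w.1) <= f p + t * w.2] =
    (fun w : R * R * R => f (p + t *: w.1) - t * w.2) @^-1` [set y | y <= f p].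
  by apply/seteqP; split=> w /=; lra.
apply: preimage_closed; last exact: closed_le.
move=> w _.
apply: cvgB.
- apply: continuous_comp; last exact: fc.
  apply: cvgD; first exact: cvg_cst.
  by apply: cvgZ; [exact: cvg_cst|exact: cvg_fst].
- by apply: cvgM; [exact: cvg_cst|exact: cvg_snd].
Qed.

Lemma slope_coneD (R : realType) (f : R * R -> R) w w' :
  slope_cone f w -> slope_cone f w' -> slope_cone f (w + w').
Proof.
move=> Ew Ew' p t t0; rewrite /= scalerDr addrA mulrDr addrA.
by apply: le_trans (Ew' _ _ t0) _; rewrite lerD2r Ew.
Qed.

Lemma slope_coneZ (R : realType) (f : R * R -> R) a w :
  0 <= a -> slope_cone f w -> slope_cone f (a *: w).
Proof.
move=> a0 Ew p t t0; rewrite /= scalerA.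
by apply: le_trans (Ew _ _ (mulr_ge0 t0 a0)) _; rewrite mulrA.
Qed.

Lemma slope_cone_up (R : realType) (f : R * R -> R) a :
  slope_cone f (0, a) <-> 0 <= a.
Proof.
split=> [/(_ 0 1 ler01)|a0 p t t0] /=; rewrite scaler0 addr0; first by rewrite mul1r; lra.
by rewrite lerDl mulr_ge0.
Qed.

Lemma slope_cone_pointed (R : realType) (f : R * R -> R) :
  continuous f -> (forall w, slope_cone f w -> slope_cone f (- w) -> w = 0) ->
  pointed_cone (slope_cone f).
Proof.
move=> fc pt; split => //; [exact: slope_cone_closed|move=> x y; exact: slope_coneD| |].
- by move=> t x; exact: slope_coneZ.
- by apply/(@slope_cone_up _ f).
Qed.

Lemma slope_cone_dilate (R : realType) (f : R * R -> R) (c : R) : 0 < c ->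
  slope_cone (fun p => c * f p) = vdilate c (slope_cone f).
Proof.
move=> c0; apply/seteqP; split=> w Ew p t t0 /=.
  rewrite -(ler_pM2l c0) mulrDr mulrCA mulVKf ?gt_eqF//; exact: Ew.
have /= := Ew p t t0; rewrite -(ler_pM2l c0) mulrDr mulrCA mulVKf ?gt_eqF//.
Qed.

(** A slope that is not taken by any chord in its direction is, by connectedness
    of the set of these chords, larger than all their slopes or smaller than
    all of them. *)
Lemma chord_free_slope (R : realType) (g : R * R -> R) (w : R * R * R) :
  continuous g -> (forall p t, 0 < t -> g (p + t *: w.1) <> g p + t * w.2) ->
  slope_cone g w \/ slope_cone g (- w).
Proof.
move=> gc free.
pose q p t := g (p + t *: w.1) - g p - t * w.2.
have q_sign p0 t0 p1 t1 : 0 < t0 -> 0 < t1 -> q p0 t0 < 0 -> 0 < q p1 t1 -> False.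
  move=> t00 t10 q0 q1.
  (* Join the two chords linearly and apply the intermediate value theorem. *)
  pose l (r : R) := p0 + r *: (p1 - p0); pose m (r : R) := t0 + r * (t1 - t0).
  have lc : continuous l.
    by move=> r; apply: cvgD; [exact: cvg_cst|apply: cvgZr_tmp; exact: cvg_id].
  have mc : continuous m.
    by move=> r; apply: cvgD; [exact: cvg_cst|apply: cvgMr_tmp; exact: cvg_id].
  have qc : continuous (fun r => q (l r) (m r)).
    move=> r; apply: cvgB; first apply: cvgB.
    + apply: continuous_comp; last exact: gc.
      by apply: cvgD; [exact: lc|apply: cvgZr_tmp; exact: mc].
    + by apply: continuous_comp; [exact: lc|exact: gc].
    + by apply: cvgMr_tmp; exact: mc.
  have e0 : q (l 0) (m 0) = q p0 t0 by rewrite /l /m scale0r mul0r !addr0.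
  have e1 : q (l 1) (m 1) = q p1 t1.
    by rewrite /l /m scale1r mul1r !(addrC _ (_ - _)) !subrK.
  have [|r] := @IVT R (fun r => q (l r) (m r)) 0 1 0 ler01 (continuous_subspaceT qc).
    by rewrite e0 e1 ge_min le_max (ltW q0) (ltW q1) orbT.
  rewrite in_itv /= => /andP [r0 r1] /eqP; rewrite /q subr_eq0 subr_eq => /eqP.
  by rewrite (addrC (_ * _)); apply: free; rewrite /m; nra.
have [q01|q01] := ltP (q 0 1) 0.
  left=> p t; rewrite le_eqVlt => /predU1P [<-|t0]; first by rewrite scale0r mul0r !addr0.
  suff : q p t <= 0 by rewrite /q; lra.
  by rewrite leNgt; apply/negP => /(q_sign 0 1 p t ltr01 t0 q01).
have {}q01 : 0 < q 0 1.
  rewrite lt_def q01 andbT; apply/eqP => /eqP; rewrite /q subr_eq0 subr_eq => /eqP.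
  by rewrite (addrC (_ * _)); exact: free.
right=> p t; rewrite le_eqVlt => /predU1P [<-|t0]; first by rewrite scale0r mul0r !addr0.
suff : 0 <= q (p - t *: w.1) t.
  by rewrite /q /= subrK scalerN mulrN; lra.
by rewrite leNgt; apply/negP => /q_sign; apply; [exact: t0|exact: ltr01|exact: q01].
Qed.

Lemma graph_imageP (R : realType) (f g : R * R -> R) (phi : R * R * R -> R * R * R) :
  bijective phi ->
  phi @` graph3 f = graph3 g <->
  forall p, p.2 = f p.1 <-> (phi p).2 = g (phi p).1.
Proof.
move=> [psi phiK psiK].
have graphE h q : graph3 h q <-> q.2 = h q.1 :> R.
  by split=> [[p _ <-]//|hq]; exists q.1 => //; rewrite -hq; case: (q).
split=> [imE p|iffE].
  rewrite -!graphE -imE; split=> [gp|[q gq /(can_inj phiK) <-//]].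
  by exists p.
apply/seteqP; split=> q.
  by move=> [p /graphE /iffE + <-]; move/graphE.
move=> /graphE gq; exists (psi q); last exact: psiK.
by apply/graphE/iffE; rewrite psiK.
Qed.

(** An isometry between graphs preserves the absence of chords in a direction.
    Tilting a direction of the slope cone slightly upwards removes the chords
    that touch it, and the cone is closed. *)
Lemma slope_cone_image (R : realType) (f g : R * R -> R)
    (A B : R * R * R -> R * R * R) (b : R * R * R) :
  continuous g -> linear_isometry A B ->
  (forall p, p.2 = f p.1 <-> (A p + b).2 = g (A p + b).1) ->
  forall w, slope_cone f w -> slope_cone g (A w) \/ slope_cone g (- A w).
Proof.
move=> gc AB fg w Ew.
have tilted e : 0 < e -> slope_cone g (A (w + e *: (0, 0, 1))) \/
    slope_cone g (- A (w + e *: (0, 0, 1))).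
  move=> e0; set w' := w + _; apply: chord_free_slope => // p' t t0 gt.
  pose p := B ((p', g p') - b).
  have Ap : A p + b = (p', g p') by rewrite /p (orthVK AB) subrK.
  have fp : p.2 = f p.1 by apply/fg; rewrite Ap.
  have : (p + t *: w').2 = f (p + t *: w').1.
    by apply/fg; rewrite (orthD AB) (orthZ AB) addrAC Ap /=.
  have := Ew p.1 t (ltW t0).
  have -> : (p + t *: w').1 = p.1 + t *: w.1.
    by rewrite /w' /=; congr (_ + _ *: _); rewrite scaler0 addr0.
  rewrite /w' /= -fp => h1 h2; move: h1; rewrite -h2 /GRing.scale /=.
  have := mulr_gt0 t0 e0; lra.
have clE := slope_cone_closed gc.
have clEN : closed [set x | slope_cone g (- x)].
  apply: (@preimage_closed _ _ (fun x : R * R * R => - x)) clE => x _; apply: cvgN; exact: cvg_id.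
apply: (@closed_sq R (slope_cone g `|` [set x | slope_cone g (- x)])).
  exact: closedU.
move=> e e0; pose d := Num.sqrt (e / 2).
have d0 : 0 < d by rewrite sqrtr_gt0; lra.
have d2 : d ^+ 2 = e / 2 by rewrite sqr_sqrtr; lra.
exists (A (w + d *: (0, 0, 1))).
  by have [?|?] := tilted _ d0; [left|right].
rewrite -(orthB AB) (orth_sq AB) opprD addNKr sqN sqZ d2 /sq /dot /=; lra.
Qed.

(** * Cones isometric to their vertical dilations *)

Lemma vertical_vectorE (R : realType) (a : R) : (0, a) = a *: (0, 0, 1) :> R * R * R.
Proof.
congr pair; last by rewrite /GRing.scale /= mulr1.
by congr pair; rewrite -[RHS]/(a *: (0 : R)) scaler0.
Qed.

Lemma closed_line (R : realType) (E : set (R * R * R)) (p q : R * R * R) (t : R) :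
  closed E -> (forall d, 0 < d -> exists2 s, `|t - s| < d & E (p + s *: q)) ->
  E (p + t *: q).
Proof.
move=> clE near_t; apply: closed_sq clE _ => e e0.
have q1 : 0 < 1 + sq q by have := sq_ge0 q; lra.
have [|s ts Es] := near_t (Num.sqrt (e / (1 + sq q))); first by rewrite sqrtr_gt0 divr_gt0.
exists (p + s *: q) => //.
rewrite opprD addrACA subrr add0r -scalerBl sqZ.
have : (t - s) ^+ 2 < e / (1 + sq q).
  rewrite -(@real_normK _ (t - s)) ?num_real//.
  rewrite -[ltRHS]sqr_sqrtr ?divr_ge0 ?ltW//.
  by rewrite ltr_pXn2r ?nnegrE ?sqrtr_ge0.
rewrite ltr_pdivlMr// => h; apply: le_lt_trans h.
by rewrite ler_wpM2l ?sqr_ge0//; lra.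
Qed.

(** When the union of a cone with its opposite is mapped into another such
    union, there is one common sign: along the half-line from [(0, 0, 1)] in the
    direction [x], the image cannot jump from [E'] to [- E'] without passing
    through the apex. *)
Lemma pointed_cone_sign (R : realType) (E E' : set (R * R * R))
    (A B : R * R * R -> R * R * R) :
  pointed_cone E -> pointed_cone E' -> linear_isometry A B ->
  (forall x, E x -> E' (A x) \/ E' (- A x)) -> E' (A (0, 0, 1)) ->
  forall x, E x -> E' (A x).
Proof.
move=> [clE ED EZ EN Ept] [clE' ED' EZ' EN' Ept'] AB AE AN x Ex.
have [//|nAx] := EM (E' (A x)).
set n := A (0, 0, 1) in AN; set y := A x in nAx *.
have line t : 0 <= t -> E' (n + t *: y) \/ E' (- (n + t *: y)).
  by move=> t0; rewrite -(orthZ AB) -(orthD AB); apply: AE; apply: ED => //; exact: EZ.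
pose S : set R := [set t | 0 <= t /\ E' (n + t *: y)].
have S0 : S 0 by split; rewrite // scale0r addr0.
have S_bounded : has_ubound S.
  apply: contrapT => unb; apply: nAx.
  rewrite -[y]addr0 -(scale0r n); apply: closed_line clE' _ => d d0.
  have [t [[t0 Et] tbig]] : exists t, S t /\ d^-1 < t.
    apply: contrapT => nt; apply: unb; exists d^-1 => t St.
    by rewrite leNgt; apply/negP => lt; apply: nt; exists t.
  have tp : 0 < t by apply: lt_trans tbig; rewrite invr_gt0.
  exists t^-1.
    by rewrite sub0r normrN gtr0_norm ?invr_gt0// invf_plt ?posrE.
  have -> : y + t^-1 *: n = t^-1 *: (n + t *: y).
    by rewrite scalerDr scalerA mulVf ?gt_eqF// scale1r addrC.
  by apply: EZ' => //; rewrite invr_ge0.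
have supS : has_sup S by split; [exists 0|].
have t0 : 0 <= sup S by exact: ub_le_sup.
set t := sup S in t0.
have Et : E' (n + t *: y).
  apply: closed_line clE' _ => d d0.
  have [s Ss lt_s] := sup_adherent d0 supS.
  exists s; last by case: Ss.
  by rewrite ger0_norm ?subr_ge0 ?ub_le_sup// ltrBlDr addrC -ltrBlDr.
have ENt : E' (- (n + t *: y)).
  rewrite opprD -scalerN; apply: closed_line clE' _ => d d0.
  exists (t + d / 2); first by rewrite opprD addNKr normrN gtr0_norm; lra.
  have [|Es|] := line (t + d / 2); first by lra.
    have : t + d / 2 <= t by apply: ub_le_sup => //; split => //; lra.
    by lra.
  by rewrite opprD scalerN.
have x0 : (0, 0, 1) + t *: x = 0.
  by rewrite -[LHS](orthK AB) (orthD AB) (orthZ AB) (Ept' _ Et ENt) (orth0 (orth_sym AB)).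
have tp : 0 < t.
  rewrite lt_def t0 andbT; apply/eqP => tz; move: x0.
  by rewrite tz scale0r addr0 => -[] /eqP; rewrite oner_eq0.
suff x00 : x = 0 by rewrite /y x00 (orth0 AB) -(scale0r (0, 0, 1)); exact: EZ'.
apply: Ept => //.
have -> : - x = t^-1 *: (0, 0, 1).
  have -> : (0, 0, 1) = t *: - x :> R * R * R.
    by rewrite scalerN; apply/eqP; rewrite -addr_eq0 x0.
  by rewrite scalerA mulVf ?gt_eqF// scale1r.
by apply: EZ => //; rewrite invr_ge0.
Qed.

Lemma pointed_cone_image (R : realType) (E E' : set (R * R * R))
    (A B : R * R * R -> R * R * R) :
  pointed_cone E -> pointed_cone E' -> linear_isometry A B ->
  (forall x, E x -> E' (A x) \/ E' (- A x)) ->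
  (forall y, E' y -> E (B y) \/ E (- B y)) -> E' (A (0, 0, 1)) ->
  forall x, E x <-> E' (A x).
Proof.
move=> ptE ptE' AB AE BE AN x; split; first exact: (pointed_cone_sign ptE ptE' AB).
move=> E'x; have := BE _ E'x; rewrite (orthK AB) => -[//|Ex].
have := pointed_cone_sign ptE ptE' AB AE AN Ex; rewrite (orthN AB) => ENx.
move: ptE ptE' => [_ _ EZ EN _] [_ _ _ _ Ept'].
rewrite -[x](orthK AB) (Ept' _ E'x ENx) (orth0 (orth_sym AB)).
by rewrite -(scale0r (0, 0, 1)); exact: EZ.
Qed.

(** As [c] tends to [0], the dilations of [(v, s)] and [(- v, s')] become almost
    opposite. *)
Lemma rigid_cone_horizontal (R : realType) (E : set (R * R * R)) v s s' :
  pointed_cone E ->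
  (forall c : R, 0 < c <= 1 -> exists A B, linear_isometry A B /\
     forall x, E x <-> vdilate c E (A x)) ->
  E (v, s) -> E (- v, s') -> v = 0.
Proof.
move=> ptE rig Ev ENv; have [d d0 gap] := pointed_cone_gap ptE.
have [v0|v0] := eqVneq v 0; first by [].
have q0 : 0 < sq (v, 0 : R).
  rewrite lt_def sq_ge0 andbT; apply/eqP => /sq_eq0 [/eqP].
  by rewrite (negPf v0).
set q := sq _ in q0.
pose K := (s + s') ^+ 2; have K0 : 0 <= K by exact: sqr_ge0.
pose c : R := d * q / (d * q + K + 1).
have dq0 : 0 < d * q by exact: mulr_gt0.
have den0 : 0 < d * q + K + 1 by lra.
have c0 : 0 < c by rewrite divr_gt0.
have c1 : c <= 1 by rewrite ler_pdivrMr//; lra.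
have cK : c * K < d * q.
  rewrite /c mulrAC ltr_pdivrMr// -subr_gt0.
  have -> : d * q * (d * q + K + 1) - d * q * K = d * q * (d * q + 1) by ring.
  by rewrite mulr_gt0//; lra.
have [|A [B [AB AE]]] := rig c; first by rewrite c0.
have gapc x y : vdilate c E x -> vdilate c E y -> d * sq x <= sq (x + y).
  rewrite -[x](orthVK AB) -[y](orthVK AB) => Ex Ey.
  rewrite -(orthD AB) !(orth_sq AB); exact: gap ((AE _).2 Ex) ((AE _).2 Ey).
have := gapc (v, c * s) (- v, c * s').
rewrite /vdilate /= !mulKf ?gt_eqF// => /(_ Ev ENv).
have -> : sq ((v, c * s) + (- v, c * s')) = c ^+ 2 * K.
  by rewrite /sq /dot /= !subrr /K; ring.
have -> : sq (v, c * s) = q + c ^+ 2 * s ^+ 2 by rewrite /q /sq /dot /=; ring.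
have := mulr_ge0 (sqr_ge0 c) (sqr_ge0 s) => cs.
have : c ^+ 2 * K <= c * K by rewrite ler_wpM2r// expr2 ger_pMl.
have := mulr_ge0 (ltW d0) cs; rewrite mulrDr => *; exfalso; lra.
Qed.

(** As [c] tends to infinity, the dilations of [(v, s)] with [s < 0] become
    almost opposite to the vertical direction. *)
Lemma rigid_cone_above (R : realType) (E : set (R * R * R)) x :
  pointed_cone E ->
  (forall c : R, 0 < c -> exists A B, linear_isometry A B /\
     forall x, E x <-> vdilate c E (A x)) ->
  E x -> 0 <= x.2.
Proof.
case: x => [v s] ptE rig Ex /=; rewrite leNgt; apply/negP => s0.
have [d d0 gap] := pointed_cone_gap ptE.
have EZ : forall t y, 0 <= t -> E y -> E (t *: y) by case: ptE.
have EN : E (0, 0, 1) by case: ptE.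
pose q := sq (v, 0 : R); have q0 : 0 <= q by exact: sq_ge0.
have ds : 0 < d * s ^+ 2 by rewrite mulr_gt0// exprn_even_gt0//= lt_eqF.
pose c : R := 1 + q / (d * s ^+ 2).
have c1 : 1 <= c by rewrite lerDl divr_ge0 ?(ltW ds).
have c0 : 0 < c by lra.
have [A [B [AB AE]]] := rig c c0.
have gapc y z : vdilate c E y -> vdilate c E z -> d * sq y <= sq (y + z).
  rewrite -[y](orthVK AB) -[z](orthVK AB) => Ey Ez.
  rewrite -(orthD AB) !(orth_sq AB); exact: gap ((AE _).2 Ey) ((AE _).2 Ez).
have := gapc (0, - (c * s)) (v, c * s); rewrite /vdilate /= mulrN !mulKf ?gt_eqF//.
rewrite (vertical_vectorE (- s)).
have Ns0 : 0 <= - s by lra.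
move=> /(_ (EZ _ _ Ns0 EN) Ex).
have -> : sq ((0, - (c * s)) + (v, c * s)) = q by rewrite /q /sq /dot /=; ring.
have -> : sq ((0, - (c * s)) : R * R * R) = c ^+ 2 * s ^+ 2 by rewrite /sq /dot /=; ring.
have : c * (d * s ^+ 2) = d * s ^+ 2 + q by rewrite /c mulrDl mul1r divfK ?gt_eqF.
have : c * (d * s ^+ 2) <= c ^+ 2 * (d * s ^+ 2).
  by rewrite ler_wpM2r ?(ltW ds)// expr2 ler_peMl// ltW.
by rewrite mulrCA; lra.
Qed.

Lemma pointed_cone_raise (R : realType) (E : set (R * R * R)) v s t :
  pointed_cone E -> E (v, s) -> s <= t -> E (v, t).
Proof.
move=> [_ ED EZ EN _] Ev st.
have -> : (v, t) = (v, s) + (t - s) *: (0, 0, 1).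
  by rewrite -vertical_vectorE; congr pair; rewrite /= ?addr0// addrC subrK.
by apply: ED => //; apply: EZ => //; lra.
Qed.

(** The dilations of [E] with [c <= 1] are nested with [E] and isometric to it,
    hence equal to it; letting [c] tend to [0] flattens [E]. *)
Lemma rigid_cone_flat (R : realType) (E : set (R * R * R)) x :
  pointed_cone E ->
  (forall c : R, 0 < c <= 1 -> exists A B, linear_isometry A B /\
     forall x, E x <-> vdilate c E (A x)) ->
  (forall x, E x -> 0 <= x.2) ->
  E x -> E (x.1, 0).
Proof.
move=> ptE rig above Ex; have clE : closed E by case: ptE.
have EcE c : 0 < c <= 1 -> forall y, E y -> E (y.1, c * y.2).
  move=> c01; have [A [B [AB AE]]] := rig c c01; have /andP [c0 c1] := c01.
  have sub y : E y -> vdilate c E y.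
    case: y => [v s] Ey; apply: (pointed_cone_raise ptE Ey) => /=.
    by have /= := above _ Ey => s0; rewrite ler_peMl// invf_ge1.
  have BE y : E y -> E (B y) by move=> /sub Ey; apply/AE; rewrite (orthVK AB).
  have AEE := orth_stable_onto (orth_sym AB) clE BE.
  move=> y Ey; have /AEE : E (B (y.1, c * y.2)).
    by apply/AE; rewrite (orthVK AB) /vdilate /= mulKf ?gt_eqF//; case: (y) Ey.
  by rewrite (orthVK AB).
have -> : (x.1, 0) = (x.1, 0) + 0 *: (0, x.2).
  by rewrite scale0r addr0.
apply: closed_line clE _ => d d0; pose c : R := Num.min 1 (d / 2).
have c0 : 0 < c by rewrite lt_min ltr01; lra.
exists c; first by rewrite sub0r normrN gtr0_norm// gt_min; lra.
have -> : (x.1, 0) + c *: (0, x.2) = (x.1, c * x.2).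
  by congr pair => /=; rewrite ?scaler0 ?addr0 ?add0r.
by apply: EcE => //; rewrite c0 ge_min lexx.
Qed.

(** If the cone lies in a vertical plane, it cannot dip below the horizontal:
    otherwise its dilations with [c <= 1] would be contained in it, hence equal to
    it, and the cone would contain the downward vertical. *)
Lemma rigid_planar_cone_above (R : realType) (E : set (R * R * R)) x :
  pointed_cone E ->
  (forall c : R, 0 < c <= 1 -> exists A B, linear_isometry A B /\
     forall x, E x <-> vdilate c E (A x)) ->
  (forall x, E x -> x.1.2 = 0) ->
  E x -> 0 <= x.2.
Proof.
move=> ptE rig planar Ex; have [clE ED EZ EN Ept] := ptE.
rewrite leNgt; apply/negP => x0.
have hor := rigid_cone_horizontal ptE rig.
have vert0 : ~ E (0, x.2).
  move=> Ed; have : E (- (0, x.2)).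
    rewrite vertical_vectorE -scaleNr.
    by apply: EZ => //; lra.
  by move=> /(Ept _ Ed) [] /eqP; rewrite lt_eqF.
have x1 : x.1.1 != 0.
  apply/eqP => x1; apply: vert0; rewrite (_ : (0, x.2) = x)//.
  by move: x1 (planar _ Ex); case: (x) => [[a b] s] /= -> ->.
have sub c y : 0 < c <= 1 -> vdilate c E y -> E y.
  move=> /andP [c0 c1]; case: y => [v w] Ey.
  have [w0|w0] := ltP w 0.
    by apply: (pointed_cone_raise ptE Ey); rewrite /= ger_nMl// invf_ge1.
  pose k := v.1 / x.1.1.
  have vE : v = k *: x.1.
    have /= v2 := planar _ Ey; move: (planar _ Ex) x1; rewrite /k.
    case: (v) v2 => [a b] /= ->; case: (x.1) => [a' b'] /= -> a'0.
    by congr pair; rewrite /= /GRing.scale /= ?mulr0 ?divfK.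
  have [k0|k0] := leP 0 k.
    apply: (@pointed_cone_raise _ _ _ (k * x.2)) => //; last first.
      by apply: le_trans w0; rewrite mulr_ge0_le0// ltW.
    have -> : (v, k * x.2) = k *: x by rewrite vE; case: (x).
    exact: EZ.
  have v0 : v = 0.
    apply: hor Ey _; last rewrite vE -scaleNr.
    have : E (- k *: x) by apply: EZ => //; lra.
    by rewrite [X in E X -> _](_ : _ = (- k *: x.1, - k * x.2)); [exact|case: (x)].
  by rewrite v0; apply: (@pointed_cone_raise _ _ _ 0) => //; rewrite vertical_vectorE; exact: EZ.
apply: vert0.
have -> : (0, x.2) = (0, x.2) + 0 *: (x.1, 0) by rewrite scale0r addr0.
apply: (closed_line clE) => d d0; pose c : R := Num.min 1 (d / 2).
have c0 : 0 < c by rewrite lt_min ltr01; lra.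
have c01 : 0 < c <= 1 by rewrite c0 ge_min lexx.
exists c; first by rewrite sub0r normrN gtr0_norm// gt_min; lra.
have [A [B [AB AE]]] := rig c c01.
have EA y : E y -> E (A y) by move=> /AE; exact: sub.
have /AE := orth_stable_onto AB clE EA Ex; rewrite (orthVK AB) => Exc.
have -> : (0, x.2) + c *: (x.1, 0) = c *: (x.1, c^-1 * x.2).
  by congr pair; rewrite /= ?add0r// /GRing.scale /= mulr0 addr0 mulVKf// gt_eqF.
by apply: EZ => //; exact: ltW.
Qed.

(** * Extreme directions of flat cones *)

(** The cones [T * [0, +oo)] where [T] is a closed convex planar cone without
    lines. *)
Definition flat_cone (R : realType) (E : set (R * R * R)) : Prop :=
  [/\ pointed_cone E, forall v s s', E (v, s) -> E (- v, s') -> v = 0,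
      forall x, E x -> 0 <= x.2 & forall x, E x -> E (x.1, 0)].

Lemma rigid_cone_flat_cone (R : realType) (E : set (R * R * R)) :
  pointed_cone E ->
  (forall c : R, 0 < c <= 1 -> exists A B, linear_isometry A B /\
     forall x, E x <-> vdilate c E (A x)) ->
  (forall x, E x -> 0 <= x.2) -> flat_cone E.
Proof.
move=> ptE rig above; split => // [v s s'|x]; first exact: rigid_cone_horizontal.
exact: rigid_cone_flat.
Qed.

Lemma flat_cone_dilate (R : realType) (E : set (R * R * R)) (c : R) x :
  flat_cone E -> 0 < c -> vdilate c E x <-> E x.
Proof.
move=> [ptE _ above flat] c0; rewrite /vdilate /=.
split=> Ex; have /= Ex0 := flat _ Ex; have /= x0 := above _ Ex.
  have -> : x = (x.1, x.2) by case: (x).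
  apply: (pointed_cone_raise ptE Ex0).
  by move: x0; rewrite pmulr_rge0// invr_gt0.
by apply: (pointed_cone_raise ptE Ex0); rewrite mulr_ge0// invr_ge0 ltW.
Qed.

Definition extreme (R : realType) (E : set (R * R * R)) (u : R * R * R) : Prop :=
  E u /\ forall x y, E x -> E y -> x + y = u -> exists r : R, x = r *: u.

(** The vertical is an extreme direction of a flat cone, so its preimage under a
    symmetry is one; splitting that preimage into its horizontal and vertical
    parts leaves only two possibilities. *)
Lemma flat_cone_vertical_preimage (R : realType) (E : set (R * R * R))
    (A B : R * R * R -> R * R * R) :
  flat_cone E -> linear_isometry A B -> (forall x, E x <-> E (A x)) ->
  B (0, 0, 1) = (0, 0, 1) \/
  [/\ (B (0, 0, 1)).2 = 0, sq (B (0, 0, 1)) = 1 & extreme E (B (0, 0, 1))].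
Proof.
move=> [ptE hor above flat] AB AE; have [clE ED EZ EN Ept] := ptE.
set u := B _.
have u1 : sq u = 1.
  by rewrite /u (orth_sq (orth_sym AB)) /sq /dot /= !mulr0 mulr1 !add0r.
have Eu : E u by apply/AE; rewrite /u (orthVK AB).
have ext : extreme E u.
  split=> // x y /AE Ax /AE Ay xy.
  have NE : A x + A y = (0, 0, 1) by rewrite -(orthD AB) xy /u (orthVK AB).
  exists (A x).2; rewrite -(orthZ (orth_sym AB)) -vertical_vectorE.
  rewrite -[LHS](orthK AB); congr B.
  move: Ax Ay NE; case: (A x) (A y) => [v s] [v' s'] Ev Ev' NE.
  have /eqP : v + v' = 0 by have := congr1 fst NE.
  rewrite addr_eq0 => /eqP vE; congr pair.
  by apply: (hor _ _ _ Ev); rewrite vE opprK; exact: Ev'.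
have [r ur] : exists r : R, (u.1, 0) = r *: u.
  apply: (ext.2 _ (0, u.2)); first exact: flat.
    by rewrite vertical_vectorE; apply: EZ => //; exact: above.
  by case: (u) => [v s]; congr pair; rewrite /= ?addr0 ?add0r.
have [u2|u2] := eqVneq u.2 0; [by right|left].
have r0 : r = 0.
  have : (u.1, 0).2 = (r *: u).2 by rewrite ur.
  by move=> /= /esym/eqP; rewrite /GRing.scale /= mulf_eq0 (negPf u2) orbF => /eqP.
have v0 : u.1 = 0 by have := congr1 fst ur; rewrite r0 scale0r.
have us : u = (0, u.2) by rewrite -v0; case: (u).
have := above _ Eu; have := u1; rewrite us /sq /dot /= !mulr0 !add0r => s1 s0.
by congr pair; nra.
Qed.

Definition det2 (R : realType) (u v : R * R * R) : R :=
  u.1.1 * v.1.2 - u.1.2 * v.1.1.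

(** A planar cone without lines has at most two extreme directions: of three
    pairwise independent vectors in the plane, one is a nonnegative combination of
    the other two, or a positive combination of all three vanishes. *)
Lemma three_extreme (R : realType) (E : set (R * R * R)) u v w :
  pointed_cone E ->
  [/\ u.2 = 0, sq u = 1 & extreme E u] ->
  [/\ v.2 = 0, sq v = 1 & extreme E v] ->
  [/\ w.2 = 0, sq w = 1 & extreme E w] ->
  [\/ u = v, u = w | v = w].
Proof.
move=> [_ ED EZ _ Ept].
have unique x y : [/\ x.2 = 0, sq x = 1 & extreme E x] ->
    [/\ y.2 = 0, sq y = 1 & extreme E y] -> det2 x y = 0 -> x = y.
  move=> [x2 x1 [Ex _]] [y2 y1 [Ey _]] xy.
  have dot1 : dot x y ^+ 2 = 1.
    have -> : dot x y ^+ 2 = sq x * sq y - det2 x y ^+ 2.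
      by rewrite /sq /dot /det2 x2 y2; ring.
    by rewrite x1 y1 xy; ring.
  have /orP [/eqP d|/eqP d] : (dot x y == 1) || (dot x y == -1) by rewrite -sqrf_eq1 dot1.
    apply/eqP; rewrite -subr_eq0; apply/eqP/sq_eq0.
    by move: x1 y1; rewrite /sq !dotE (dotC y x) d => -> ->; ring.
  have xN : x = - y.
    apply/eqP; rewrite -addr_eq0; apply/eqP/sq_eq0.
    by move: x1 y1; rewrite /sq !dotE (dotC y x) d => -> ->; ring.
  have y0 : y = 0 by apply: Ept => //; rewrite -xN.
  by move: y1; rewrite y0 /sq /dot /= !mulr0 !addr0 => /eqP; rewrite eq_sym oner_eq0.
have no_comb x y z a b c : [/\ x.2 = 0, sq x = 1 & extreme E x] ->
    [/\ y.2 = 0, sq y = 1 & extreme E y] -> [/\ z.2 = 0, sq z = 1 & extreme E z] ->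
    0 < a -> 0 < b -> 0 < c -> det2 x z != 0 -> a *: x + b *: y = c *: z -> False.
  move=> [x2 x1 [Ex _]] [y2 y1 [Ey _]] [z2 z1 [Ez extz]] a0 b0 c0 /eqP xz comb.
  have ci : 0 <= c^-1 by rewrite invr_ge0 ltW.
  have [r xr] : exists r : R, (c^-1 * a) *: x = r *: z.
    apply: (extz _ ((c^-1 * b) *: y)); [apply: EZ => //|apply: EZ => //|].
    - by rewrite mulr_ge0// ltW.
    - by rewrite mulr_ge0// ltW.
    - by rewrite -!scalerA -scalerDr comb scalerA mulVf ?scale1r// gt_eqF.
  apply: xz; have ca : c^-1 * a != 0 by rewrite mulf_neq0 ?invr_eq0 ?gt_eqF.
  apply: (mulfI ca); rewrite mulr0.
  have -> : c^-1 * a * det2 x z = det2 ((c^-1 * a) *: x) z.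
    by rewrite /det2 /= /GRing.scale /=; ring.
  by rewrite xr /det2 /= /GRing.scale /=; ring.
have no_zero x y z a b c : [/\ x.2 = 0, sq x = 1 & extreme E x] ->
    [/\ y.2 = 0, sq y = 1 & extreme E y] -> [/\ z.2 = 0, sq z = 1 & extreme E z] ->
    0 < a -> 0 < b -> 0 < c -> a *: x + b *: y = - (c *: z) -> False.
  move=> [x2 x1 [Ex _]] [y2 y1 [Ey _]] [z2 z1 [Ez extz]] a0 b0 c0 comb.
  have cz : c *: z = 0.
    apply: Ept; first by apply: EZ => //; exact: ltW.
    by rewrite -comb; apply: ED; apply: EZ => //; exact: ltW.
  move: z1; have := sqZ c z; rewrite cz /sq /dot /= !mulr0 !addr0 => /esym/eqP.
  by rewrite mulf_eq0 expf_eq0 /= gt_eqF//= => /eqP -> /eqP; rewrite eq_sym oner_eq0.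
move=> hu hv hw.
have [/eqP uv|uv] := boolP (det2 u v == 0); first by constructor 1; exact: unique.
have [/eqP uw|uw] := boolP (det2 u w == 0); first by constructor 2; exact: unique.
have [/eqP vw|vw] := boolP (det2 v w == 0); first by constructor 3; exact: unique.
have det2C x y : det2 x y = - det2 y x by rewrite /det2; ring.
have cyc : det2 v w *: u + det2 w u *: v + det2 u v *: w = 0.
  move: hu hv hw => [+ _ _] [+ _ _] [+ _ _]; rewrite /det2.
  case: (u) (v) (w) => [[a b] c] [[a' b'] c'] [[a'' b''] c''] /= -> -> ->.
  by congr ((_, _), _); rewrite /= /GRing.scale /=; ring.
have wu : det2 w u != 0 by rewrite det2C oppr_eq0.
have vu : det2 v u != 0 by rewrite det2C oppr_eq0.
have wv : det2 w v != 0 by rewrite det2C oppr_eq0.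
exfalso.
(* By [cyc], the signs of the three determinants decide which of the three
   vectors is a positive combination of the others. *)
set p := det2 v w in cyc vw; set q := det2 w u in cyc wu; set r := det2 u v in cyc uv.
have solve (x y z : R * R * R) : x + y + z = 0 -> x + y = - z.
  by move=> /eqP; rewrite addr_eq0 => /eqP.
have cyc1 : q *: v + r *: w + p *: u = 0 by rewrite -cyc addrC addrA.
have cyc2 : r *: w + p *: u + q *: v = 0 by rewrite -cyc1 addrC addrA.
have neg (a : R) : a < 0 -> 0 < - a by rewrite oppr_gt0.
have cycN (x y z : R * R * R) a b c :
    a *: x + b *: y + c *: z = 0 -> (- a) *: x + (- b) *: y + (- c) *: z = 0.
  by rewrite !scaleNr -!opprD => ->; rewrite oppr0.
have toN (a : R) (x y z : R * R * R) : x + y + a *: z = 0 -> x + y = (- a) *: z.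
  by move=> /solve ->; rewrite scaleNr.
have [p0|p0] := ltP 0 p; have [q0|q0] := ltP 0 q; have [r0|r0] := ltP 0 r;
  rewrite ?(le_eqVlt p) ?(le_eqVlt q) ?(le_eqVlt r)
    ?(negPf vw) ?(negPf wu) ?(negPf uv) /= in p0 q0 r0.
- exact: (no_zero u v w p q r _ _ _ _ _ _ (solve _ _ _ cyc)).
- exact: (no_comb u v w p q (- r) _ _ _ _ _ (neg _ r0) uw (toN _ _ _ _ cyc)).
- exact: (no_comb w u v r p (- q) _ _ _ _ _ (neg _ q0) wv (toN _ _ _ _ cyc2)).
- apply: (no_comb v w u (- q) (- r) p _ _ _ (neg _ q0) (neg _ r0) p0 vu) => //.
  by have := toN _ _ _ _ (cycN _ _ _ _ _ _ cyc1); rewrite opprK.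
- exact: (no_comb v w u q r (- p) _ _ _ _ _ (neg _ p0) vu (toN _ _ _ _ cyc1)).
- apply: (no_comb w u v (- r) (- p) q _ _ _ (neg _ r0) (neg _ p0) q0 wv) => //.
  by have := toN _ _ _ _ (cycN _ _ _ _ _ _ cyc2); rewrite opprK.
- apply: (no_comb u v w (- p) (- q) r _ _ _ (neg _ p0) (neg _ q0) r0 uw) => //.
  by have := toN _ _ _ _ (cycN _ _ _ _ _ _ cyc); rewrite opprK.
- exact: (no_zero u v w (- p) (- q) (- r) _ _ _ (neg _ p0) (neg _ q0) (neg _ r0)
    (solve _ _ _ (cycN _ _ _ _ _ _ cyc))).
Qed.

(** Only three directions can play the role of the vertical: the vertical itself
    and at most two horizontal extreme directions. So two among four consecutive
    indices agree. *)
Lemma flat_cone_pigeonhole (R : realType) (E : set (R * R * R))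
    (B : nat -> R * R * R -> R * R * R) :
  flat_cone E ->
  (forall n, exists2 A, linear_isometry A (B n) & forall x, E x <-> E (A x)) ->
  exists i k, (k < 3)%N /\ B i (0, 0, 1) = B (i + k.+1)%N (0, 0, 1).
Proof.
move=> flE rig; have ptE : pointed_cone E by case: flE.
set N : R * R * R := (0, 0, 1); set P : R * R * R -> Prop := fun u =>
  [/\ u.2 = 0, sq u = 1 & extreme E u].
have cases n : B n N = N \/ P (B n N).
  by have [A AB AE] := rig n; exact: (flat_cone_vertical_preimage flE AB AE).
suff [i [k [ik k4 e]]] : exists i k, [/\ (i < k)%N, (k < 4)%N & B i N = B k N].
  exists i, (k - i.+1)%N; split; first by rewrite ltn_subLR// addSnnS (leq_trans k4)// leq_addl.
  by rewrite -addSnnS subnKC.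
have three i j k : (i < j < k)%N -> (k < 4)%N -> P (B i N) -> P (B j N) -> P (B k N) ->
    exists i k, [/\ (i < k)%N, (k < 4)%N & B i N = B k N].
  move=> /andP [ij jk] k4 Pi Pj Pk; case: (three_extreme ptE Pi Pj Pk) => e.
  - by exists i, j; split => //; exact: ltn_trans jk k4.
  - by exists i, k; split => //; exact: ltn_trans ij jk.
  - by exists j, k.
have two i j : (i < j < 4)%N -> B i N = N -> B j N = N ->
    exists i k, [/\ (i < k)%N, (k < 4)%N & B i N = B k N].
  by move=> /andP [ij j4] ei ej; exists i, j; rewrite ei ej.
have [e0|P0] := cases 0%N; have [e1|P1] := cases 1%N.
- exact: (two 0%N 1%N).
- have [e2|P2] := cases 2%N; first exact: (two 0%N 2%N).
  have [e3|P3] := cases 3%N; first exact: (two 0%N 3%N).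
  exact: (three 1%N 2%N 3%N).
- have [e2|P2] := cases 2%N; first exact: (two 1%N 2%N).
  have [e3|P3] := cases 3%N; first exact: (two 1%N 3%N).
  exact: (three 0%N 2%N 3%N).
- have [e2|P2] := cases 2%N; last exact: (three 0%N 1%N 2%N).
  have [e3|P3] := cases 3%N; first exact: (two 2%N 3%N).
  exact: (three 0%N 1%N 3%N).
Qed.

(** * Functional equations from isometries *)

Definition graph_isometry (R : realType) (f g : R * R -> R)
    (A B : R * R * R -> R * R * R) (b : R * R * R) : Prop :=
  linear_isometry A B /\ forall p, p.2 = f p.1 <-> (A p + b).2 = g (A p + b).1.

Lemma graph_isometryP (R : realType) (f g : R * R -> R) :
  (exists phi, isometry3 phi /\ phi @` graph3 f = graph3 g) ->
  exists A B b, graph_isometry f g A B b.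
Proof.
move=> [phi [iso /graph_imageP]]; have [A [B [AB phiE]]] := isometry3_affine iso.
move=> /(_ iso.1) fg; exists A, B, (phi 0); split => // p.
by rewrite -phiE.
Qed.

Lemma graph_isometry_sym (R : realType) (f g : R * R -> R) A B (b : R * R * R) :
  graph_isometry f g A B b -> graph_isometry g f B A (- B b).
Proof.
move=> [AB fg]; split; first exact: orth_sym.
move=> p; rewrite -(orthB (orth_sym AB)); have := fg (B (p - b)).
by rewrite (orthVK AB) subrK => h; split=> /h.
Qed.

Lemma graph_isometry_comp (R : realType) (f g h : R * R -> R) A B b A' B'
    (b' : R * R * R) :
  graph_isometry f g A B b -> graph_isometry g h A' B' b' ->
  graph_isometry f h (A' \o A) (B \o B') (A' b + b').
Proof.
move=> [AB fg] [AB' gh]; split; first exact: orth_comp.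
move=> p; apply: (iff_trans (fg p)); apply: (iff_trans (gh _)).
by rewrite (orthD AB') [(A' \o A) p]/= addrA; exact: iff_refl.
Qed.

Lemma pointed_cone_signed (R : realType) (E E' : set (R * R * R))
    (A B : R * R * R -> R * R * R) :
  pointed_cone E -> pointed_cone E' -> linear_isometry A B ->
  (forall x, E x -> E' (A x) \/ E' (- A x)) ->
  (forall y, E' y -> E (B y) \/ E (- B y)) ->
  exists e : R, [/\ e = 1 \/ e = -1,
    linear_isometry (fun x => e *: A x) (fun x => e *: B x) &
    forall x, E x <-> E' (e *: A x)].
Proof.
move=> ptE ptE' AB AE BE; have EN : E (0, 0, 1) by case: ptE.
have [AN|AN] := AE _ EN.
  exists 1; split; [by left| |].
    rewrite (_ : (fun x => _) = A); last by apply/funext => x; rewrite scale1r.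
    by rewrite (_ : (fun x => _) = B)//; apply/funext => x; rewrite scale1r.
  by move=> x; rewrite scale1r; exact: (pointed_cone_image ptE ptE' AB).
exists (-1); split; [by right| |].
  rewrite (_ : (fun x => _) = (fun x => - A x)); last by apply/funext => x; rewrite scaleN1r.
  rewrite (_ : (fun x => _ *: B x) = (fun x => - B x)); last by apply/funext => x;
    rewrite scaleN1r.
  exact: linear_isometry_opp.
move=> x; rewrite scaleN1r; apply: (pointed_cone_image ptE ptE' (linear_isometry_opp AB)) => //.
- by move=> y /AE [?|?]; [right; rewrite opprK|left].
- by move=> y /BE [?|?]; [right; rewrite opprK|left].
Qed.

(** Orthogonal transformations of the plane are rotations ([s = 1]) and
    reflections ([s = -1]), followed here by a translation. *)
Definition planar_isometry (R : realType) (psi : R * R -> R * R) : Prop :=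
  exists a b s : R, exists t : R * R,
    [/\ a ^+ 2 + b ^+ 2 = 1, s ^+ 2 = 1 &
      forall p, psi p = (a * p.1 - s * b * p.2, b * p.1 + s * a * p.2) + t].

(** The graph of [l * f] is the image of the graph of [f] under an isometry that
    preserves the vertical direction up to sign. *)
Definition scales_by (R : realType) (f : R * R -> R) (l : R) : Prop :=
  exists psi (e d : R), [/\ planar_isometry psi, e ^+ 2 = 1 &
    forall p, f (psi p) = e * l * f p + d].

Lemma planar_isometry_comp (R : realType) (psi psi' : R * R -> R * R) :
  planar_isometry psi -> planar_isometry psi' -> planar_isometry (psi' \o psi).
Proof.
move=> [a [b [s [t [ab ss psiE]]]]] [a' [b' [s' [t' [ab' ss' psiE']]]]].
exists (a' * a - s' * b' * b), (b' * a + s' * a' * b), (s * s').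
exists (psi' t); split.
- transitivity ((a ^+ 2 + b ^+ 2) * (a' ^+ 2 + b' ^+ 2) +
    (s' ^+ 2 - 1) * b ^+ 2 * (a' ^+ 2 + b' ^+ 2)); first by ring.
  by rewrite ab ab' ss'; ring.
- by rewrite exprMn ss ss' mulr1.
- move=> p; rewrite /= !psiE' psiE.
  have s2 : s' * s' = 1 by rewrite -expr2.
  congr pair => /=.
    transitivity (a' * a * p.1 - a' * s * b * p.2 - s' * b' * b * p.1
      - s' * s * b' * a * p.2 + (a' * t.1 - s' * b' * t.2 + t'.1)); first by ring.
    rewrite -[X in a' * X * b * p.2](mulr1 s) -s2; ring.
  transitivity (b' * a * p.1 - b' * s * b * p.2 + s' * a' * b * p.1
      + s' * s * a' * a * p.2 + (b' * t.1 + s' * a' * t.2 + t'.2)); first by ring.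
  rewrite -[X in b' * X * b * p.2](mulr1 s) -s2; ring.
Qed.

Lemma scales_byM (R : realType) (f : R * R -> R) (l m : R) :
  scales_by f l -> scales_by f m -> scales_by f (l * m).
Proof.
move=> [psi [e [d [psiI ee psiE]]]] [psi' [e' [d' [psiI' ee' psiE']]]].
exists (psi' \o psi), (e * e'), (e' * m * d + d'); split.
- exact: planar_isometry_comp.
- by rewrite exprMn ee ee' mulr1.
- by move=> p /=; rewrite psiE' psiE; ring.
Qed.

Lemma scales_byX (R : realType) (f : R * R -> R) (l : R) n :
  scales_by f l -> scales_by f (l ^+ n.+1).
Proof.
by move=> fl; elim: n => [|n IH]; [rewrite expr1|rewrite exprS; exact: scales_byM].
Qed.

(** The horizontal plane is preserved, being orthogonal to the vertical. *)
Lemma isometry_fixing_vertical (R : realType) (A B : R * R * R -> R * R * R) (e : R) :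
  linear_isometry A B -> e ^+ 2 = 1 -> A (0, 0, 1) = e *: (0, 0, 1) ->
  exists a b s : R, [/\ a ^+ 2 + b ^+ 2 = 1, s ^+ 2 = 1 &
    forall p, A p = (a * p.1.1 - s * b * p.1.2, b * p.1.1 + s * a * p.1.2, e * p.2)].
Proof.
move=> AB e1 AN; have e0 : e != 0.
  by apply/eqP => e0; move: e1; rewrite e0 expr0n /= => /eqP; rewrite eq_sym oner_eq0.
have hor v : (A (v, 0)).2 = 0.
  have := orth_dot AB (v, 0) (0, 0, 1); rewrite AN dotZr.
  rewrite /dot /= !mulr0 !mul0r !addr0 mulr1 add0r => /eqP.
  by rewrite mulf_eq0 (negPf e0) => /eqP.
have AE p : A p = p.1.1 *: A (1, 0, 0) + p.1.2 *: A (0, 1, 0) + p.2 *: (e *: (0, 0, 1)).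
  rewrite -AN -!(orthZ AB) -!(orthD AB); congr A; case: p => [[x y] z].
  by congr ((_, _), _); rewrite /= /GRing.scale /=; ring.
have := orth_dot AB (1, 0, 0) (1, 0, 0); have := orth_dot AB (0, 1, 0) (0, 1, 0).
have := orth_dot AB (1, 0, 0) (0, 1, 0); move: AE (hor (1, 0)) (hor (0, 1)).
case: (A (1, 0, 0)) (A (0, 1, 0)) => [[a b] z] [[c d] z'] AE /= z0 z0'.
rewrite {}z0 {}z0' in AE *; rewrite /dot /= !mulr0 !mulr1 !addr0 !add0r => ac cc aa.
exists a, b, (a * d - b * c); split.
- by rewrite !expr2.
- have -> : (a * d - b * c) ^+ 2 = (a * a + b * b) * (c * c + d * d) -
    (a * c + b * d) ^+ 2 by ring.
  by rewrite aa cc ac; ring.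
- have cE : (a * d - b * c) * b = - c.
    transitivity ((a * c + b * d) * a - (a * a + b * b) * c); first by ring.
    by rewrite aa ac; ring.
  have dE : (a * d - b * c) * a = d.
    transitivity ((a * a + b * b) * d - (a * c + b * d) * b); first by ring.
    by rewrite aa ac; ring.
  move=> p; rewrite AE cE dE -vertical_vectorE.
  by congr ((_, _), _); rewrite /= /GRing.scale /=; ring.
Qed.

(** Composing one isometry with the inverse of another gives an isometry that
    preserves the vertical line, that is a functional equation for [f]. *)
Lemma common_vertical_scales (R : realType) (f : R * R -> R) (c c' : R)
    A B b A' B' (b' : R * R * R) (e : R) :
  c' != 0 ->
  graph_isometry f (fun p => c * f p) A B b ->
  graph_isometry f (fun p => c' * f p) A' B' b' ->
  e ^+ 2 = 1 -> B (0, 0, 1) = e *: B' (0, 0, 1) -> scales_by f (c / c').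
Proof.
move=> c'0 gA gA' ee BN.
have [AB gI] := graph_isometry_comp (graph_isometry_sym gA) gA'.
set t := A' _ + b' in gI.
have AN : (A' \o B) (0, 0, 1) = e *: (0, 0, 1).
  by rewrite /= BN (orthZ gA'.1) (orthVK gA'.1).
have [a [d [s [ad ss AE]]]] := isometry_fixing_vertical AB ee AN.
exists (fun p => (a * p.1 - s * d * p.2, d * p.1 + s * a * p.2) + t.1), e, (t.2 / c').
split => //; first by exists a, d, s, t.1.
move=> p; have /= [+ _] := gI (p, c * f p) => /(_ erefl).
rewrite -[A' (B _)]/((A' \o B) _) AE /= => h.
apply: (mulfI c'0); rewrite mulrDr.
have -> : c' * (t.2 / c') = t.2 by rewrite mulrC divfK.
have -> : c' * (e * (c / c') * f p) = e * (c * f p) by field.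
by rewrite h.
Qed.

(** Among four dilation factors two preimages of the vertical agree, by the
    pigeonhole principle. As the admissible ratios are closed under products,
    it is enough to apply this to the powers of a sixth root of [l]. *)
Lemma flat_cone_scales (R : realType) (f : R * R -> R) (E : set (R * R * R)) (l : R) :
  flat_cone E ->
  (forall c : R, 0 < c <= 1 -> exists A B b (e : R),
     [/\ graph_isometry f (fun p => c * f p) A B b, e = 1 \/ e = -1,
       linear_isometry (fun x => e *: A x) (fun x => e *: B x) &
       forall x, E x <-> vdilate c E (e *: A x)]) ->
  0 < l < 1 -> scales_by f l.
Proof.
move=> flE rig /andP [l0 l1].
pose m := expR (ln l / 6).
have m0 : 0 < m by exact: expR_gt0.
have m6 : m ^+ 6 = l by rewrite -expRM_natl mulrC divfK// lnK.
have m1 : m <= 1.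
  have /ln_lt0 lnl : 0 < l < 1 by rewrite l0.
  by rewrite /m -[leRHS]expR0 ler_expR; lra.
have c01 n : 0 < m ^+ n <= 1 by rewrite exprn_gt0// exprn_ile1// ltW.
have [A /choice [B /choice [b /choice [e ABe]]]] := choice (fun n => rig _ (c01 n)).
have [|i [k [k3 BN]]] := @flat_cone_pigeonhole _ E (fun n x => e n *: B n x) flE.
  move=> n; have [_ _ AB AE] := ABe n; exists (fun x => e n *: A n x) => // x.
  by apply: (iff_trans (AE x)); apply: flat_cone_dilate; rewrite ?exprn_gt0.
have [gi ei _ _] := ABe i; have [gj ej _ _] := ABe (i + k.+1)%N.
have e2 n : e n ^+ 2 = 1.
  by have [_ [->|->] _ _] := ABe n; rewrite ?expr1n// sqrrN expr1n.
have mk : scales_by f (m ^+ k.+1).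
  have -> : m ^+ k.+1 = m ^+ (i + k.+1) / m ^+ i.
    by rewrite exprD mulrAC divff ?mul1r// expf_neq0// gt_eqF.
  apply: (common_vertical_scales (e := e (i + k.+1)%N * e i) _ gj gi).
  - by rewrite expf_neq0// gt_eqF.
  - by rewrite exprMn !e2 mulr1.
  - by rewrite -scalerA BN scalerA -expr2 e2 scale1r.
rewrite -m6; case: k k3 {BN gj ej} mk => [|[|[|//]]] _ mk.
- exact: (scales_byX 5 mk).
- by have := scales_byX 2 mk; rewrite -exprM.
- by have := scales_byX 1 mk; rewrite -exprM.
Qed.

(** * Reduction to translations *)

(** The square of a planar isometry preserves the orientation. *)
Lemma planar_isometry_square (R : realType) (psi : R * R -> R * R) :
  planar_isometry psi ->
  exists a b : R, exists t : R * R, a ^+ 2 + b ^+ 2 = 1 /\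
    forall p, psi (psi p) = (a * p.1 - b * p.2, b * p.1 + a * p.2) + t.
Proof.
move=> [a [b [s [t [ab ss psiE]]]]].
exists (a ^+ 2 - s * b ^+ 2), (a * b + s * a * b), (psi t).
have s2 : s * s = 1 by rewrite -expr2.
split.
  transitivity ((a ^+ 2 + b ^+ 2) ^+ 2 + (s * s - 1) * (b ^+ 2 * (a ^+ 2 + b ^+ 2)));
    first by ring.
  by rewrite ab s2; ring.
move=> p; rewrite !psiE; congr pair => /=.
  transitivity (a * a * p.1 - a * s * b * p.2 - s * b * b * p.1
    - s * s * b * a * p.2 + (a * t.1 - s * b * t.2 + t.1)); first by ring.
  by rewrite s2; ring.
transitivity (b * a * p.1 - s * b * b * p.2 + s * a * b * p.1
    + s * s * a * a * p.2 + (b * t.1 + s * a * t.2 + t.2)); first by ring.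
by rewrite s2; ring.
Qed.

Lemma disc_compact (R : realType) (r : R) :
  compact [set p : R * R | p.1 ^+ 2 + p.2 ^+ 2 <= r].
Proof.
pose I := [set` `[- (1 + r), 1 + r] ].
apply: (@subclosed_compact _ _ (I `*` I)).
- rewrite -[X in closed X]/((fun p : R * R => p.1 ^+ 2 + p.2 ^+ 2) @^-1` [set y | y <= r]).
  apply: preimage_closed; last exact: closed_le.
  by move=> p _; apply: cvgD; apply: cvgM; (exact: cvg_fst || exact: cvg_snd).
- by apply: compact_setX; exact: segment_compact.
- move=> [x y] /=; rewrite !expr2 => h; have := sqr_ge0 x; have := sqr_ge0 y.
  by rewrite /= !expr2 => y0 x0; split; rewrite /I /= in_itv /=; apply/andP; split; nra.
Qed.

(** A linear rotation preserves the discs around the origin, so it cannot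
    multiply the maximum of the absolute value of [h] on a disc by [l < 1] unless that maximum is
    [0]. *)
Lemma rotation_scaling_eq0 (R : realType) (h : R * R -> R) (a b l : R) :
  continuous h -> a ^+ 2 + b ^+ 2 = 1 -> 0 < l < 1 ->
  (forall p, h (a * p.1 - b * p.2, b * p.1 + a * p.2) = l * h p) ->
  forall p, h p = 0.
Proof.
move=> hc ab /andP [l0 l1] hE p.
pose r := p.1 ^+ 2 + p.2 ^+ 2; pose K := [set q : R * R | q.1 ^+ 2 + q.2 ^+ 2 <= r].
have [||c] := @compact_EVT_max _ _ (fun q => `|h q|) K _ (@disc_compact R r).
- by exists p; rewrite /K /= lexx.
- by apply: continuous_subspaceT => q; apply: cvg_norm; exact: hc.
rewrite inE => Kc cmax.
have hc0 : `|h c| <= 0.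
  pose c' : R * R := (a * c.1 + b * c.2, - b * c.1 + a * c.2).
  have cE : c = (a * c'.1 - b * c'.2, b * c'.1 + a * c'.2).
    have xE (x : R) : x = (a ^+ 2 + b ^+ 2) * x by rewrite ab mul1r.
    rewrite [c in LHS](_ : c = (c.1, c.2)); last by case: (c).
    by congr pair; rewrite /c' /= [LHS]xE; ring.
  have Kc' : K c'.
    rewrite /K /c' /=; apply: le_trans Kc.
    rewrite [leLHS](_ : _ = (a ^+ 2 + b ^+ 2) * (c.1 ^+ 2 + c.2 ^+ 2)); last by ring.
    by rewrite ab mul1r.
  have : `|h c| <= l * `|h c|.
    rewrite {1}cE hE normrM gtr0_norm// ler_pM2l//.
    by apply: cmax; rewrite inE.
  by have := normr_ge0 (h c); nra.
apply/eqP; rewrite -normr_le0; apply: le_trans hc0.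
by apply: cmax; rewrite inE /K /= lexx.
Qed.

(** The squares of the given isometries are rotations or translations, and
    rotations have fixed points. *)
Lemma scales_by_translation (R : realType) (f : R * R -> R) :
  continuous f -> (exists p q, f p <> f q) ->
  (forall l : R, 0 < l < 1 -> scales_by f l) ->
  forall l : R, 0 < l < 1 -> exists t d, forall p, f (p + t) = l * f p + d.
Proof.
move=> fc [p0 [q0 pq]] fs l /andP [l0 l1].
have [m m01 ml] : exists2 m : R, 0 < m < 1 & m ^+ 2 = l.
  exists (Num.sqrt l); last by rewrite sqr_sqrtr// ltW.
  by rewrite sqrtr_gt0 l0 -sqrtr1 ltr_sqrt.
have [psi [e [d [psiI ee psiE]]]] := fs m m01.
have [a [b [t [ab psi2]]]] := planar_isometry_square psiI.
set D := e * m * d + d.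
have f2 p : f ((a * p.1 - b * p.2, b * p.1 + a * p.2) + t) = l * f p + D.
  rewrite -psi2 !psiE /D -ml.
  transitivity (e ^+ 2 * (m ^+ 2 * f p) + (e * m * d + d)); first by ring.
  by rewrite ee mul1r.
have [a1|a1] := eqVneq a 1.
  have b0 : b = 0 by apply/eqP; rewrite -sqrf_eq0; apply/eqP; move: ab; rewrite a1; lra.
  exists t, D => p; rewrite -f2 a1 b0; congr (f (_ + t)).
  by case: p => [x y]; rewrite /= !mul1r !mul0r subr0 add0r.
exfalso; apply: pq.
have a2 : 2 - 2 * a != 0 by rewrite -{1}(mulr1 2) -mulrBr mulf_neq0// subr_eq0 eq_sym.
pose o : R * R := (((1 - a) * t.1 - b * t.2) / (2 - 2 * a),
                   (b * t.1 + (1 - a) * t.2) / (2 - 2 * a)).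
have oE : (a * o.1 - b * o.2, b * o.1 + a * o.2) + t = o.
  have bb : b ^+ 2 = 1 - a ^+ 2 by rewrite -ab; ring.
  have o1 : o.1 * (2 - 2 * a) = (1 - a) * t.1 - b * t.2 by rewrite divfK.
  have o2 : o.2 * (2 - 2 * a) = b * t.1 + (1 - a) * t.2 by rewrite divfK.
  clearbody o; rewrite [RHS](_ : o = (o.1, o.2)); last by case: (o).
  congr pair; apply: (mulIf a2); rewrite /=.
    transitivity (a * (o.1 * (2 - 2 * a)) - b * (o.2 * (2 - 2 * a)) + t.1 * (2 - 2 * a));
      first by ring.
    rewrite o1 o2; transitivity (t.1 * (2 - a - a ^+ 2 - b ^+ 2) - b * t.2); first by ring.
    by rewrite bb; ring.
  transitivity (b * (o.1 * (2 - 2 * a)) + a * (o.2 * (2 - 2 * a)) + t.2 * (2 - 2 * a));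
    first by ring.
  rewrite o1 o2; transitivity (t.2 * (2 - a - a ^+ 2 - b ^+ 2) + b * t.1); first by ring.
  by rewrite bb; ring.
have hE := @rotation_scaling_eq0 R (fun p => f (p + o) - f o) a b l _ ab _ _.
have const p : f p = f o.
  apply/eqP; rewrite -subr_eq0 -{1}(subrK o p); apply/eqP; apply: hE; last first.
  - move=> q /=; have fo := f2 o; rewrite oE in fo.
    have -> : (a * q.1 - b * q.2, b * q.1 + a * q.2) + o =
        (a * (q + o).1 - b * (q + o).2, b * (q + o).1 + a * (q + o).2) + t.
      by rewrite -[X in _ + X = _]oE; congr pair => /=; ring.
    by rewrite f2; lra.
  - by rewrite l0.
  - move=> q; apply: cvgB; last exact: cvg_cst.
    apply: continuous_comp; last exact: fc.
    by apply: cvgD; [exact: cvg_id|exact: cvg_cst].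
by rewrite !const.
Qed.

(** The translations commute, which makes the constants [d] proportional to
    [1 - l]. *)
Lemma common_constant (R : realType) (f : R * R -> R) :
  (forall l : R, 0 < l < 1 -> exists t d, forall p, f (p + t) = l * f p + d) ->
  exists a0 : R, forall l : R, 0 < l < 1 ->
    exists t, forall p, f (p + t) - a0 = l * (f p - a0).
Proof.
move=> fl; have [|t0 [d0 f0]] := fl (1 / 2); first by apply/andP; split; lra.
exists (2 * d0) => l l01; have [t [d fE]] := fl l l01; exists t => p.
have : f (p + t + t0) = f (p + t0 + t) by rewrite addrAC.
by rewrite f0 !fE f0; lra.
Qed.

Lemma additive_bounded_eq0 (R : realType) (d : R -> R) (C : R) :
  (forall x y, d (x + y) = d x + d y) -> (forall x, `|d x| <= C) ->
  forall x, d x = 0.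
Proof.
move=> dD dC x; have d0 : d 0 = 0.
  by apply: (@addrI _ (d 0)); rewrite -dD !addr0.
have dn n : d (x *+ n) = d x *+ n.
  by elim: n => [|n IH]; rewrite ?mulr0n// !mulrS dD IH.
apply/eqP; apply/negPn/negP => dx.
have dx0 : 0 < `|d x| by rewrite normr_gt0.
have C0 : 0 <= C / `|d x| by rewrite divr_ge0// (le_trans _ (dC x)).
have /andP [_] := truncn_itv C0.
rewrite ltr_pdivrMr// mulrC mulr_natr -normrMn -dn => /lt_le_trans /(_ (dC _)).
by rewrite ltxx.
Qed.

(** The difference of the two sides is additive, vanishes on the integers, and
    so is bounded by its maximum on the unit interval. *)
Lemma additive_continuous_linear (R : realType) (u : R -> R) :
  continuous u -> (forall x y, u (x + y) = u x + u y) ->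
  forall x, u x = u 1 * x.
Proof.
move=> uc uD x; pose d t := u t - u 1 * t.
have dD s t : d (s + t) = d s + d t by rewrite /d uD; ring.
have dc : continuous d.
  by move=> t; apply: cvgB; [exact: uc|apply: cvgM; [exact: cvg_cst|exact: cvg_id]].
have d1 : d 1 = 0 by rewrite /d mulr1 subrr.
have d0 : d 0 = 0 by apply: (@addrI _ (d 0)); rewrite -dD !addr0.
have dN t : d (- t) = - d t by apply: (@addrI _ (d t)); rewrite -dD !subrr d0.
have dn (n : nat) : d n%:R = 0.
  by elim: n => [|n IH]; rewrite ?d0// -natr1 dD IH d1 addr0.
have dz (z : int) : d z%:~R = 0.
  by case: z => n; rewrite ?NegzE ?mulrNz ?dN dn ?oppr0.
have [|c _ cmax] := @EVT_max R (fun t => `|d t|) 0 1 ler01.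
  by apply: continuous_subspaceT => t; apply: cvg_norm; exact: dc.
have dC t : `|d t| <= `|d c|.
  have -> : d t = d (t - (Num.floor t)%:~R) by rewrite dD dN dz oppr0 addr0.
  apply: cmax; rewrite in_itv /= subr_ge0 floor_le /= lerBlDr addrC.
  by have /ltW := floorD1_gt t; rewrite intrD.
have : d x = 0 by exact: (additive_bounded_eq0 dD dC).
by rewrite /d => /eqP; rewrite subr_eq0 => /eqP.
Qed.

(** * Closed subgroups of the plane and exponentials *)

Lemma unit_interval_not_countable (R : realType) (T : countType) (u : R -> T) :
  ~ (forall x y, 0 < x < 1 -> 0 < y < 1 -> u x = u y -> x = y).
Proof.
move=> inj; have : countable [set` `]0, 1[ : interval R].
  apply/countable_injP; exists (pickle \o u) => x y.
  rewrite !inE /= !in_itv /= => x01 y01 /= e; apply: inj => //.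
  exact: (pcan_inj pickleK e).
move=> /countable_lebesgue_measure0; rewrite lebesgue_measure_itv /= lte_fin ltr01.
by rewrite oppr0 adde0 => /eqP; rewrite eqe oner_eq0.
Qed.

(** An uncountable subgroup of the plane is not discrete: a discrete one would
    have at most one element in each cell of a fine grid. *)
Lemma uncountable_small_elements (R : realType) (P : set (R * R)) (tau : R -> R * R) :
  (forall x y, P x -> P y -> P (x - y)) ->
  (forall l : R, 0 < l < 1 -> P (tau l)) ->
  (forall l m : R, 0 < l < 1 -> 0 < m < 1 -> tau l = tau m -> l = m) ->
  forall e : R, 0 < e -> exists v, [/\ P v, v != 0 & sq (v, 0) < e].
Proof.
move=> PB Ptau tau_inj e e0; apply: contrapT => discrete.
have s0 : 0 < Num.sqrt (e / 2) by rewrite sqrtr_gt0; lra.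
have s2 : Num.sqrt (e / 2) ^+ 2 = e / 2 by rewrite sqr_sqrtr//; lra.
set s := Num.sqrt _ in s0 s2.
have cell x y : Num.floor (x / s) = Num.floor (y / s) -> (x - y) ^+ 2 < e / 2.
  move=> xy; have := floor_le (x / s); have := floorD1_gt (x / s).
  have := floor_le (y / s); have := floorD1_gt (y / s).
  rewrite xy intrD => y1 y0 x1 x0.
  have : `|(x - y) / s| < 1 by rewrite ltr_norml mulrBl; apply/andP; split; lra.
  rewrite normrM normfV (gtr0_norm s0) ltr_pdivrMr// mul1r => xys.
  by rewrite -s2 -real_normK ?num_real// ltr_pXn2r// nnegrE// ltW.
apply: (@unit_interval_not_countable R _
  (fun l => (Num.floor ((tau l).1 / s), Num.floor ((tau l).2 / s)))).
move=> l m l01 m01 [/cell c1 /cell c2]; apply: tau_inj => //.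
apply/eqP/negPn/negP => lm; apply: discrete; exists (tau l - tau m); split.
- by apply: PB; exact: Ptau.
- by rewrite subr_eq0.
- by rewrite /sq /dot /= mulr0 addr0 -!expr2; lra.
Qed.

(** Small nonzero elements have, up to a subsequence, a limiting direction, and
    their integer multiples become dense in the line with that direction. *)
Lemma closed_subgroup_line (R : realType) (P : set (R * R)) :
  closed P -> P 0 -> (forall x y, P x -> P y -> P (x - y)) ->
  (forall e : R, 0 < e -> exists v, [/\ P v, v != 0 & sq (v, 0) < e]) ->
  exists2 v, v != 0 & forall t : R, P (t *: v).
Proof.
move=> clP P0 PB small.
have PN x : P x -> P (- x) by move=> Px; rewrite -sub0r; exact: PB.
have PD x y : P x -> P y -> P (x + y) by move=> Px Py; rewrite -(opprK y); apply: PB => //;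
  exact: PN.
have Pn n x : P x -> P (x *+ n) by move=> Px; elim: n => [|n IH]; rewrite ?mulr0n// mulrS;
  exact: PD.
have seq n : exists ru : R * (R * R), [/\ 0 < ru.1, ru.1 ^+ 2 < n.+1%:R^-1,
    sq (ru.2, 0) = 1 & P (ru.1 *: ru.2)].
  have [|v [Pv v0 ve]] := small n.+1%:R^-1; first by rewrite invr_gt0.
  have q0 : 0 < sq (v, 0 : R).
    rewrite lt_def sq_ge0 andbT; apply/eqP => /sq_eq0 vz.
    by move/eqP: v0; apply; have := congr1 fst vz.
  have r0 : 0 < Num.sqrt (sq (v, 0 : R)) by rewrite sqrtr_gt0.
  have r2 : Num.sqrt (sq (v, 0 : R)) ^+ 2 = sq (v, 0 : R) by rewrite sqr_sqrtr// ltW.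
  set r := Num.sqrt _ in r0 r2.
  exists (r, r^-1 *: v); split => //=; first by rewrite r2.
    have -> : (r^-1 *: v, 0) = r^-1 *: (v, 0 : R) by congr pair; rewrite /= scaler0.
    by rewrite sqZ exprVn r2 mulVf// gt_eqF.
  by rewrite scalerA mulfV ?scale1r// gt_eqF.
have [ru ruP] := choice seq.
have [|y cly] := @bounded_cluster R (fun n => ((ru n).2, 0)) 1.
  by move=> n; have [_ _ ->] := ruP n.
have y1 : y.1 != 0.
  apply/eqP => y0; have [n _] := cly 1 ltr01 0%N; have [_ _ + _] := ruP n.
  move: y0; case: y {cly} => [v s] /= ->.
  rewrite /sq /dot /= => ru1; have := sqr_ge0 s; rewrite expr2; lra.
exists y.1 => //.
have pos t : 0 <= t -> P (t *: y.1).
  move=> t0; have clP' : closed [set x : R * R * R | P x.1].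
    by apply: (@preimage_closed _ _ (fun x : R * R * R => x.1)) clP => x _; exact: cvg_fst.
  apply: (@closed_sq _ [set x | P x.1] (t *: y.1, 0)) clP' _ => e e0.
  have t2 : 0 < 1 + t ^+ 2 by have := sqr_ge0 t; lra.
  have e4 : 0 < e / 4 by lra.
  have et : 0 < e / 4 / (1 + t ^+ 2) by rewrite divr_gt0.
  have [N Ne] : exists N : nat, (N.+1%:R^-1 : R) < e / 4.
    by have := near_infty_natSinv_lt (PosNum e4); case=> N _ /(_ N (leqnn N)) /=; exists N.
  have [m Nm my] := cly _ et N.
  have [r0 rm u1 Pru] := ruP m.
  set r := (ru m).1 in r0 rm Pru; set u := (ru m).2 in my u1 Pru.
  have re : r ^+ 2 < e / 4.
    apply: lt_trans rm (le_lt_trans _ Ne).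
    by rewrite lef_pV2 ?posrE// ler_nat ltnS.
  have tr : 0 <= t / r by rewrite divr_ge0// ltW.
  have /andP [k0 k1] := truncn_itv tr; set k := Num.trunc _ in k0 k1.
  (* [k] is the integer part of [t / r], so that [k * r] is within [r] of [t]. *)
  exists ((r *: u) *+ k, 0); first exact: Pn.
  move: k0 k1; rewrite ler_pdivlMr// ltr_pdivrMr// -natr1 mulrDl mul1r => k0 k1.
  have -> : (t *: y.1, 0) - ((r *: u) *+ k, 0) =
      ((t *: (y.1 - u), 0) + (t - k%:R * r) *: (u, 0)) :> R * R * R.
    congr pair; rewrite /= ?scaler0 ?subr0 ?addr0//.
    rewrite scalerBr scalerBl addrA subrK; congr (_ - _).
    by rewrite -scaler_nat scalerA.
  apply: le_lt_trans (sqD_le _ _) _; rewrite sqZ u1 mulr1.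
  have kr : (t - k%:R * r) ^+ 2 <= r ^+ 2.
    by rewrite ler_pXn2r ?nnegrE//; lra.
  have -> : (t *: (y.1 - u), 0) = t *: (y.1 - u, 0 : R) by congr pair; rewrite /= scaler0.
  rewrite sqZ.
  have : sq (y.1 - u, 0 : R) < e / 4 / (1 + t ^+ 2).
    apply: le_lt_trans my; case: (y) => [v s]; rewrite /sq /dot /=.
    by have := sqr_ge0 s; rewrite expr2; lra.
  rewrite ltr_pdivlMr// => h.
  have : t ^+ 2 * sq (y.1 - u, 0 : R) <= sq (y.1 - u, 0 : R) * (1 + t ^+ 2).
    by have := sq_ge0 (y.1 - u, 0 : R); lra.
  lra.
move=> t; have [t0|t0] := leP 0 t; first exact: pos.
by rewrite -(opprK t) scaleNr; apply/PN/pos; lra.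
Qed.

(** The translations that rescale [h] form a closed subgroup, uncountable since
    all ratios occur. On a line contained in it, the ratio is a continuous
    homomorphism to the multiplicative group, hence an exponential. The set [W]
    restricts the translations that are considered. *)
Lemma exponential_line (R : realType) (h : R * R -> R) (W : set (R * R)) :
  continuous h -> (exists p, h p != 0) ->
  closed W -> W 0 -> (forall x y, W x -> W y -> W (x - y)) ->
  (forall l : R, 0 < l < 1 -> exists2 t, W t & forall p : R * R, h (p + t) = l * h p) ->
  exists v (k : R), [/\ v != 0, forall t : R, W (t *: v) &
    forall (p : R * R) (t : R), h (p + t *: v) = expR (k * t) * h p].
Proof.
move=> hc [p0 hp0] clW W0 WB scale.
pose P : set (R * R) :=
  [set t | W t /\ exists2 l : R, 0 < l & forall p : R * R, h (p + t) = l * h p].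
have P0 : P 0 by split => //; exists 1 => // p; rewrite addr0 mul1r.
have PB x y : P x -> P y -> P (x - y).
  move=> [Wx [l l0 lx]] [Wy [m m0 my]]; split; first exact: WB.
  exists (l / m); first by rewrite divr_gt0.
  move=> p; have := my (p + (x - y)); rewrite -addrA subrK lx => e.
  by rewrite mulrAC e mulrC mulKf// gt_eqF.
have clP : closed P.
  have -> : P = W `&` [set t | 0 <= h (p0 + t) / h p0] `&`
      \bigcap_p [set t | h (p + t) - h (p0 + t) / h p0 * h p = 0].
    apply/seteqP; split=> t.
      move=> [Wt [l l0 lt]]; have e : h (p0 + t) / h p0 = l by rewrite lt mulfK.
      split; first by split => //=; rewrite e ltW.
      by move=> p _ /=; rewrite e lt subrr.
    move=> [[Wt /= r0] eqs].
    have {}eqs p : h (p + t) = h (p0 + t) / h p0 * h p.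
      by have := eqs p Logic.I => /= /eqP; rewrite subr_eq0 => /eqP.
    split=> //; exists (h (p0 + t) / h p0) => //.
    rewrite lt_def r0 andbT; apply/eqP => rz.
    by move/eqP: hp0; apply; rewrite -(subrK t p0) eqs rz mul0r.
  have hpc (p : R * R) : continuous (fun t : R * R => h (p + t)).
    move=> t; apply: continuous_comp; last exact: hc.
    by apply: cvgD; [exact: cvg_cst|exact: cvg_id].
  have rc : continuous (fun t : R * R => h (p0 + t) / h p0).
    by move=> t; apply: cvgM; [exact: hpc|exact: cvg_cst].
  apply: closedI; first apply: closedI => //.
    rewrite -[X in closed X]/((fun t : R * R => h (p0 + t) / h p0) @^-1` [set y | 0 <= y]).
    by apply: preimage_closed; [move=> t _; exact: rc|exact: closed_ge].
  apply: closed_bigI => p _.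
  rewrite -[X in closed X]/((fun t : R * R => h (p + t) -
    h (p0 + t) / h p0 * h p) @^-1` [set y | y = 0]).
  apply: preimage_closed; last exact: closed_eq.
  move=> t _; apply: cvgB; first exact: hpc.
  by apply: cvgM; [exact: rc|exact: cvg_cst].
have tauP (l : R) : exists t, 0 < l < 1 -> W t /\ forall p : R * R, h (p + t) = l * h p.
  have [l01|] := boolP (0 < l < 1); last by exists 0.
  by have [t Wt lt] := scale l l01; exists t.
have {tauP} [tau tauP] := choice tauP.
have [|v v0 Pv] := closed_subgroup_line clP P0 PB.
  apply: (uncountable_small_elements (tau := tau) PB).
    move=> l l01; have [Wl hl] := tauP l l01; split => //.
    by exists l => //; case/andP: l01.
  move=> l m l01 m01 lm; apply: (mulIf hp0).
  by rewrite -(tauP l l01).2 -(tauP m m01).2 lm.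
pose r (t : R) := h (p0 + t *: v) / h p0.
have rP t : 0 < r t /\ forall p : R * R, h (p + t *: v) = r t * h p.
  have [_ [l l0 lt]] := Pv t; have -> : r t = l by rewrite /r lt mulfK.
  by [].
have rc : continuous r.
  move=> t; apply: cvgM; last exact: cvg_cst.
  apply: continuous_comp; last exact: hc.
  by apply: cvgD; [exact: cvg_cst|apply: cvgZr_tmp; exact: cvg_id].
have rM s t : r (s + t) = r s * r t.
  by rewrite {1}/r scalerDl addrA (rP t).2 (rP s).2 mulrA mulfK// mulrC.
pose u t := ln (r t).
have uc : continuous u.
  by move=> t; apply: continuous_comp; [exact: rc|apply: continuous_ln; exact: (rP t).1].
have uD s t : u (s + t) = u s + u t.
  by rewrite /u rM lnM ?posrE//; apply: (rP _).1.
have uE := additive_continuous_linear uc uD.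
exists v, (u 1); split => //; first by move=> t; have [] := Pv t.
move=> p t; rewrite -uE lnK ?posrE; last exact: (rP t).1.
exact: (rP t).2.
Qed.

(** * Rotations and cylinders *)

Definition zrot (R : realType) (c s : R) (p : R * R * R) : R * R * R :=
  (c * p.1.1 - s * p.1.2, s * p.1.1 + c * p.1.2, p.2).

Definition xrot (R : realType) (c s : R) (p : R * R * R) : R * R * R :=
  (p.1.1, c * p.1.2 - s * p.2, s * p.1.2 + c * p.2).

Lemma zrot_isometry (R : realType) (c s : R) :
  c ^+ 2 + s ^+ 2 = 1 -> linear_isometry (zrot c s) (zrot c (- s)).
Proof.
move=> cs; have csE x : (c ^+ 2 + s ^+ 2) * x = x by rewrite cs mul1r.
split=> [a p q|p q|[[x y] z]|[[x y] z]].
- by congr ((_, _), _); rewrite /= /GRing.scale /=; ring.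
- rewrite /dot /zrot /=;
    transitivity ((c ^+ 2 + s ^+ 2) * (p.1.1 * q.1.1 + p.1.2 * q.1.2) + p.2 * q.2); first by ring.
  by rewrite csE.
- by rewrite /zrot /=; congr ((_, _), _); rewrite -[RHS]csE; ring.
- by rewrite /zrot /=; congr ((_, _), _); rewrite -[RHS]csE; ring.
Qed.

Lemma xrot_isometry (R : realType) (c s : R) :
  c ^+ 2 + s ^+ 2 = 1 -> linear_isometry (xrot c s) (xrot c (- s)).
Proof.
move=> cs; have csE x : (c ^+ 2 + s ^+ 2) * x = x by rewrite cs mul1r.
split=> [a p q|p q|[[x y] z]|[[x y] z]].
- by congr ((_, _), _); rewrite /= /GRing.scale /=; ring.
- rewrite /dot /xrot /=;
    transitivity (p.1.1 * q.1.1 + (c ^+ 2 + s ^+ 2) * (p.1.2 * q.1.2 + p.2 * q.2)); first by ring.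
  by rewrite csE; ring.
- by rewrite /xrot /=; congr ((_, _), _); rewrite -[RHS]csE; ring.
- by rewrite /xrot /=; congr ((_, _), _); rewrite -[RHS]csE; ring.
Qed.

Lemma id_isometry (R : realType) : linear_isometry (@id (R * R * R)) id.
Proof. by []. Qed.

Lemma vertically_rigidP (R : realType) (f : R * R -> R) :
  vertically_rigid f <->
  forall c, 0 < c -> exists A B b, graph_isometry f (fun p => c * f p) A B b.
Proof.
split=> rig c /rig; first exact: graph_isometryP.
move=> [A [B [b [AB fg]]]]; exists (fun p => A p + b).
have bij : bijective (fun p => A p + b).
  exists (fun p => B (p - b)) => p; first by rewrite addrK (orthK AB).
  by rewrite (orthVK AB) subrK.
split; last exact/graph_imageP.
split=> // p q; apply/dist3_sq.
by rewrite opprD addrACA subrr addr0 -(orthB AB) (orth_sq AB).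
Qed.

Lemma graph_isometry_rotation (R : realType) (f : R * R -> R) (theta : R) :
  exists A B, graph_isometry (f \o rotation2 theta) f A B 0.
Proof.
exists (zrot (cos theta) (sin theta)), (zrot (cos theta) (- sin theta)).
by split=> [|p]; [apply: zrot_isometry; exact: cos2Dsin2|rewrite addr0].
Qed.

Lemma vertically_rigid_rotation (R : realType) (f : R * R -> R) (theta : R) :
  vertically_rigid f -> vertically_rigid (f \o rotation2 theta).
Proof.
move=> /vertically_rigidP rig; apply/vertically_rigidP => c /rig [A [B [b gA]]].
have [J [K gJ]] := graph_isometry_rotation f theta.
have [J' [K' /graph_isometry_sym gJ']] :=
  graph_isometry_rotation (fun p => c * f p) theta.
have g := graph_isometry_comp (graph_isometry_comp gJ gA) gJ'.
by eexists; eexists; eexists; exact: g.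
Qed.

Lemma rotation2N (R : realType) (theta : R) p :
  rotation2 theta (rotation2 (- theta) p) = p.
Proof.
have csE x : (cos theta ^+ 2 + sin theta ^+ 2) * x = x by rewrite cos2Dsin2 mul1r.
case: p => [x y]; rewrite /rotation2 /= cosN sinN; congr pair; rewrite -[RHS]csE; ring.
Qed.

Lemma vertically_rigid_unrotation (R : realType) (f : R * R -> R) (theta : R) :
  vertically_rigid (f \o rotation2 theta) -> vertically_rigid f.
Proof.
move=> /(@vertically_rigid_rotation _ _ (- theta)).
rewrite (_ : (f \o _) \o _ = f)//; apply/funext => p /=.
by rewrite rotation2N.
Qed.

Lemma rotation2_split (R : realType) (theta x y : R) :
  rotation2 theta (x, y) =
  x *: (cos theta, sin theta) + y *: (- sin theta, cos theta).
Proof. by congr pair; rewrite /= /GRing.scale /=; ring. Qed.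

Lemma rotation2_continuous (R : realType) (theta : R) :
  continuous (@rotation2 R theta).
Proof.
move=> p; rewrite /rotation2.
apply: (@cvg_pair _ _ _ _ (nbhs (cos theta * p.1 - sin theta * p.2))
  (nbhs (sin theta * p.1 + cos theta * p.2))).
  by apply: cvgB; apply: cvgM; (exact: cvg_cst || exact: cvg_fst || exact: cvg_snd).
by apply: cvgD; apply: cvgM; (exact: cvg_cst || exact: cvg_fst || exact: cvg_snd).
Qed.

Lemma polar (R : realType) (v : R * R) : v != 0 ->
  exists (theta r : R), 0 < r /\ v = r *: (cos theta, sin theta).
Proof.
case: v => [x y] v0; set r := Num.sqrt (x ^+ 2 + y ^+ 2).
have q0 : 0 < x ^+ 2 + y ^+ 2.
  have x2 := sqr_ge0 x; have y2 := sqr_ge0 y.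
  rewrite lt_def addr_ge0// andbT paddr_eq0// !sqrf_eq0.
  by apply: contra v0 => /andP [/eqP -> /eqP ->].
have r0 : 0 < r by rewrite sqrtr_gt0.
have r2 : r ^+ 2 = x ^+ 2 + y ^+ 2 by rewrite sqr_sqrtr// ltW.
have xr2 : (x / r) ^+ 2 + (y / r) ^+ 2 = 1.
  by rewrite !expr_div_n -mulrDl -r2 mulfV// expf_neq0// gt_eqF.
have xr1 : -1 <= x / r <= 1.
  by have := sqr_ge0 (y / r) => y2; apply/andP; split; nra.
have ca : cos (acos (x / r)) = x / r by apply: acosK; rewrite in_itv.
have sa : sin (acos (x / r)) = `|y / r|.
  by rewrite sin_acos// -xr2 addrC addKr sqrtr_sqr.
have [y0|y0] := leP 0 (y / r).
  exists (acos (x / r)), r; split => //.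
  by rewrite ca sa ger0_norm//; congr pair; rewrite /= /GRing.scale /= mulrC divfK// gt_eqF.
exists (- acos (x / r)), r; split => //.
rewrite cosN sinN ca sa ltr0_norm// opprK.
by congr pair; rewrite /= /GRing.scale /= mulrC divfK// gt_eqF.
Qed.

(** The graph of [u x + m * y] is a cylinder with generator [(0, 1, m)]; turning
    the generator to the horizontal shows its profile. *)
Lemma cylinder_graph (R : realType) (u : R -> R) (m : R) :
  exists A B, graph_isometry (fun p => u p.1 + m * p.2)
    (fun p => u p.1 / Num.sqrt (1 + m ^+ 2)) A B 0.
Proof.
have m1 : 0 < 1 + m ^+ 2 by have := sqr_ge0 m; lra.
have r0 : 0 < Num.sqrt (1 + m ^+ 2) by rewrite sqrtr_gt0.
have r2 : Num.sqrt (1 + m ^+ 2) ^+ 2 = 1 + m ^+ 2 by rewrite sqr_sqrtr// ltW.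
set r := Num.sqrt _ in r0 r2 *.
exists (xrot r^-1 (- m / r)), (xrot r^-1 (- (- m / r))); split.
  apply: xrot_isometry; rewrite exprVn expr_div_n sqrrN -[X in X + _]mul1r -mulrDl -r2.
  by rewrite mulfV// expf_neq0// gt_eqF.
case=> [[x y] z]; rewrite addr0 /xrot /=.
have -> : - m / r * y + r^-1 * z = (z - m * y) / r by ring.
have ri : r^-1 != 0 by rewrite invr_eq0 gt_eqF.
by split=> [->|/(mulIf ri) <-]; rewrite ?addrK ?subrK.
Qed.

Lemma vdilate_pointed (R : realType) (E : set (R * R * R)) (c : R) :
  0 < c -> pointed_cone E -> pointed_cone (vdilate c E).
Proof.
move=> c0 ptE; have [clE ED EZ EN Ept] := ptE; split.
- apply: (@preimage_closed _ _ (fun x : R * R * R => (x.1, c^-1 * x.2))) clE => x _.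
  apply: (@cvg_pair _ _ _ _ (nbhs x.1) (nbhs (c^-1 * x.2))); first exact: cvg_fst.
  by apply: cvgM; [exact: cvg_cst|exact: cvg_snd].
- by move=> x y Ex Ey; rewrite /vdilate /= mulrDr; exact: (ED _ _ Ex Ey).
- move=> t x t0 Ex; rewrite /vdilate /=.
  have -> : c^-1 * (t *: x.2) = t *: (c^-1 * x.2) by rewrite /GRing.scale /= mulrCA.
  exact: (EZ _ _ t0 Ex).
- by rewrite /vdilate /= mulr1 (vertical_vectorE c^-1); apply: EZ => //; rewrite invr_ge0 ltW.
- move=> x Ex ENx; have := Ept _ Ex; rewrite /vdilate /= mulrN in ENx.
  move=> /(_ ENx) x0; have v0 := congr1 fst x0; have /eqP := congr1 snd x0.
  rewrite /= mulf_eq0 invr_eq0 gt_eqF//= => /eqP s0.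
  by case: (x) v0 s0 => [v s] /= -> ->.
Qed.

Lemma slope_cone_line (R : realType) (f : R * R -> R) w :
  slope_cone f w -> slope_cone f (- w) ->
  forall p (t : R), f (p + t *: w.1) = f p + t * w.2.
Proof.
move=> Ew ENw; have pos p t : 0 <= t -> f (p + t *: w.1) = f p + t * w.2.
  move=> t0; apply/eqP; rewrite eq_le Ew//=.
  have := ENw (p + t *: w.1) t t0; rewrite /= scalerN addrK mulrN; lra.
move=> p t; have [t0|t0] := leP 0 t; first exact: pos.
have := pos (p + t *: w.1) (- t); rewrite scaleNr addrK mulNr => -> //; lra.
Qed.

(** * Rigid functions *)

(** The slope cone inherits the rigidity of the graph, up to a sign. *)
Lemma slope_cone_rigid (R : realType) (f : R * R -> R) (c : R) A B b :
  continuous f -> pointed_cone (slope_cone f) -> 0 < c ->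
  graph_isometry f (fun p => c * f p) A B b ->
  exists e : R, [/\ e = 1 \/ e = -1,
    linear_isometry (fun x => e *: A x) (fun x => e *: B x) &
    forall x, slope_cone f x <-> vdilate c (slope_cone f) (e *: A x)].
Proof.
move=> fc ptE c0 gA; have cfc : continuous (fun p => c * f p).
  by move=> p; apply: cvgM; [exact: cvg_cst|exact: fc].
have gB := graph_isometry_sym gA.
apply: (pointed_cone_signed ptE (vdilate_pointed c0 ptE) gA.1).
  by rewrite -slope_cone_dilate// => x; exact: (slope_cone_image cfc gA.1 gA.2).
by rewrite -slope_cone_dilate// => x; exact: (slope_cone_image fc gB.1 gB.2).
Qed.

(** When the slope cone contains no line, the functional equations make [f - a0]
    exponential along a line. The exponent is not zero, since otherwise the
    direction of this line would give a line in the slope cone. *)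
Lemma rigid_pointed (R : realType) (f : R * R -> R) :
  continuous f -> vertically_rigid f -> pointed_cone (slope_cone f) ->
  exists theta, separated_exp_form (f \o rotation2 theta).
Proof.
move=> fc /vertically_rigidP rig ptE.
have noline v : (forall p (t : R), f (p + t *: v) = f p) -> v = 0.
  move=> fv; have [_ _ _ _ Ept] := ptE.
  have /(congr1 fst) //: (v, 0) = 0 :> R * R * R.
  by apply: Ept => p t _ /=; rewrite ?oppr0 ?scalerN -?scaleNr fv mulr0 addr0.
have rigE (c : R) : 0 < c -> exists A B b (e : R),
    [/\ graph_isometry f (fun p => c * f p) A B b, e = 1 \/ e = -1,
      linear_isometry (fun x => e *: A x) (fun x => e *: B x) &
      forall x, slope_cone f x <-> vdilate c (slope_cone f) (e *: A x)].
  move=> c0; have [A [B [b gA]]] := rig c c0.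
  have [e [e1 AB AE]] := slope_cone_rigid fc ptE c0 gA.
  by exists A, B, b, e.
have rigE' (c : R) : 0 < c -> exists A B, linear_isometry A B /\
    forall x, slope_cone f x <-> vdilate c (slope_cone f) (A x).
  move=> /rigE [A [B [b [e [_ _ AB AE]]]]].
  by exists (fun x => e *: A x), (fun x => e *: B x).
have flE : flat_cone (slope_cone f).
  apply: (rigid_cone_flat_cone ptE) => [c /andP [c0 _]|x Ex]; first exact: rigE'.
  exact: (rigid_cone_above ptE rigE').
have scale (l : R) : 0 < l < 1 -> scales_by f l.
  by apply: (flat_cone_scales flE) => c /andP [c0 _]; exact: rigE.
have nonconst : exists p q, f p <> f q.
  apply: contrapT => const; have /eqP : (1, 0) = 0 :> R * R; last first.
    by rewrite xpair_eqE oner_eq0.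
  apply: noline => p t; apply: contrapT => ne; apply: const.
  by exists (p + t *: (1, 0)), p.
have [a0 hE] := common_constant (scales_by_translation fc nonconst scale).
pose h p := f p - a0.
have hc : continuous h by move=> p; apply: cvgB; [exact: fc|exact: cvg_cst].
have h0 : exists p, h p != 0.
  have [p [q pq]] := nonconst; have [hp|?] := eqVneq (h p) 0; last by exists p.
  exists q; apply/eqP => hq; apply: pq; apply/eqP.
  by rewrite -(inj_eq (addIr (- a0))) -/(h p) -/(h q) hp hq.
have [||l l01|v [k [v0 _ hv]]] := @exponential_line _ h setT hc h0 closedT.
- by [].
- by [].
- by have [t ht] := hE l l01; exists t.
have fE p : f p = h p + a0 by rewrite /h subrK.
have k0 : k != 0.
  apply/eqP => kz; move/eqP: v0; apply; apply: noline => p t.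
  by rewrite !fE hv kz mul0r expR0 mul1r.
have [theta [r [r0 vE]]] := polar v0.
exists theta, a0, (k / r), (fun y => h (y *: (- sin theta, cos theta))).
split.
- by rewrite mulf_neq0// invr_eq0 gt_eqF.
- move=> y.
  apply: (@continuous_comp _ _ _ (fun y : R => y *: (- sin theta, cos theta)) h); last exact: hc.
  by apply: cvgZr_tmp; exact: cvg_id.
- move=> x y; rewrite /= fE rotation2_split [LHS]addrC (addrC (x *: _)).
  have -> : x *: (cos theta, sin theta) = (x / r) *: v.
    by rewrite vE scalerA divfK// gt_eqF.
  by rewrite hv mulrC mulrAC mulrA.
Qed.

(** A function of one variable, seen as a cylinder over its graph. Its isometries
    preserve the generator of the cylinder, unless it is affine; the argument
    for pointed cones then applies to the trace of the slope cone on the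
    vertical plane of the curve. *)
Lemma rigid_curve (R : realType) (G : R -> R) :
  continuous G ->
  (forall c : R, 0 < c <= 1 -> exists A B b,
     graph_isometry (fun p : R * R => G p.1) (fun p => c * G p.1) A B b) ->
  (exists a b : R, forall x, G x = a + b * x) \/
  (exists a b k : R, k != 0 /\ forall x, G x = a + b * expR (k * x)).
Proof.
move=> Gc rig.
have [?|nonaff] := EM (exists a b : R, forall x, G x = a + b * x); [by left|right].
have noslope (a s : R) : (forall x t, G (x + t * a) = G x + t * s) -> a = 0.
  move=> Ga; apply: contrapT => /eqP a0; apply: nonaff.
  exists (G 0), (s / a) => x; have := Ga 0 (x / a).
  by rewrite divfK// add0r => ->; ring.
pose F p := G (p : R * R).1.
have Fc : continuous F.
  by move=> p; apply: continuous_comp; [exact: cvg_fst|exact: Gc].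
pose Y : set (R * R * R) := [set x | x.1.2 = 0].
pose E := slope_cone F `&` Y.
have clY : closed Y.
  rewrite -[Y]/((fun x : R * R * R => x.1.2) @^-1` [set y | y = 0]).
  apply: preimage_closed; last exact: closed_eq.
  by move=> x _; apply: (@cvg_comp _ _ _ (fun x : R * R * R => x.1) snd);
    [exact: cvg_fst|exact: cvg_snd].
have ptE : pointed_cone E.
  split.
  - by apply: closedI => //; exact: slope_cone_closed.
  - move=> x y [Ex Yx] [Ey Yy]; split; first exact: slope_coneD.
    by move: Yx Yy; rewrite /Y /= => -> ->; rewrite addr0.
  - move=> t x t0 [Ex Yx]; split; first exact: slope_coneZ.
    by move: Yx; rewrite /Y /= => ->; rewrite /GRing.scale /= mulr0.
  - by split => //; apply/(@slope_cone_up _ F).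
  - move=> w [Ew Yw] [ENw _]; have wE := slope_cone_line Ew ENw.
    have w11 : w.1.1 = 0.
      by apply: (noslope _ w.2) => x t; exact: (wE (x, 0) t).
    have w2 : w.2 = 0.
      have := wE 0 1; rewrite /F /= w11 /GRing.scale /= mulr0 addr0 mul1r; lra.
    by move: Yw w11 w2; rewrite /Y /=; case: (w) => [[x y] z] /= -> -> ->.
have rigE (c : R) : 0 < c <= 1 -> exists A B b (e : R),
    [/\ graph_isometry F (fun p => c * F p) A B b, e = 1 \/ e = -1,
      linear_isometry (fun x => e *: A x) (fun x => e *: B x) &
      forall x, E x <-> vdilate c E (e *: A x)].
  move=> c01; have /andP [c0 c1] := c01; have [A [B [b gA]]] := rig c c01.
  have [AB fg] := gA; pose ey : R * R * R := (0, 1, 0); set w := A ey.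
  (* The graph of [F] is invariant under translation along [ey], so the graph of
     [c * F] is invariant under translation along [w]. *)
  have wE (p : R * R) t : c * G (p.1 + t * w.1.1) = c * G p.1 + t * w.2.
    pose q := B ((p, c * G p.1) - b).
    have Aq : A q + b = (p, c * G p.1) by rewrite /q (orthVK AB) subrK.
    have qG : q.2 = G q.1.1 by apply/fg; rewrite Aq.
    have qtG : (q + t *: ey).2 = G (q + t *: ey).1.1.
      by rewrite /= /GRing.scale /= !mulr0 !addr0.
    by have := (fg _).1 qtG; rewrite (orthD AB) (orthZ AB) addrAC Aq => /esym.
  have w11 : w.1.1 = 0.
    apply: (noslope _ (w.2 / c)) => x t; apply: (mulfI (negbT (gt_eqF c0))).
    by rewrite (wE (x, 0)) mulrDr /=; congr (_ + _); field; rewrite gt_eqF.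
  have w2 : w.2 = 0 by have := wE (0, 0) 1; rewrite w11 /= mulr0 addr0 mul1r; lra.
  have w12 : w.1.2 ^+ 2 = 1.
    have := orth_sq AB ey; rewrite -/w /sq /dot w11 w2 /ey /= expr2; lra.
  have w0 : w.1.2 != 0.
    by apply/eqP => wz; move: w12; rewrite wz expr2 mulr0 => /eqP; rewrite eq_sym oner_eq0.
  have YA x : Y x -> Y (A x).
    rewrite /Y /= => Yx; have := orth_dot AB x ey.
    rewrite -/w {1}/dot w11 w2 /dot Yx /ey /= => h; apply: (mulIf w0); lra.
  have YB x : Y x -> Y (B x).
    rewrite /Y /= => Yx; have := orth_dot AB (B x) ey.
    rewrite (orthVK AB) -/w {1}/dot w11 w2 Yx /dot /ey /=; lra.
  have cFc : continuous (fun p => c * F p).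
    by move=> p; apply: cvgM; [exact: cvg_cst|exact: Fc].
  have gB := graph_isometry_sym gA.
  have NY x : Y x -> Y (- x) by rewrite /Y /= => ->; rewrite oppr0.
  have slopeF := slope_cone_dilate F c0.
  have [||e [e1 ABe AE]] := pointed_cone_signed ptE (vdilate_pointed c0 ptE) AB.
  - move=> x [Ex Yx]; have := slope_cone_image cFc gA.1 gA.2 Ex; rewrite slopeF.
    by move=> [h|h]; [left|right]; split => //; [exact: YA|exact/NY/YA].
  - move=> x [Ex Yx]; have := slope_cone_image Fc gB.1 gB.2; rewrite slopeF => /(_ _ Ex).
    by move=> [h|h]; [left|right]; split => //; [exact: YB|exact/NY/YB].
  by exists A, B, b, e.
have rigE' (c : R) : 0 < c <= 1 -> exists A B, linear_isometry A B /\
    forall x, E x <-> vdilate c E (A x).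
  move=> /rigE [A [B [b [e [_ _ AB AE]]]]].
  by exists (fun x => e *: A x), (fun x => e *: B x).
have flE : flat_cone E.
  apply: (rigid_cone_flat_cone ptE rigE') => x.
  by apply: (rigid_planar_cone_above ptE rigE') => y [_].
have scale (l : R) : 0 < l < 1 -> scales_by F l by exact: (flat_cone_scales flE rigE).
have nonconst : exists p q, F p <> F q.
  apply: contrapT => const; apply: nonaff; exists (G 0), 0 => x.
  rewrite mul0r addr0; apply: contrapT => ne; apply: const.
  by exists (x, 0), (0, 0).
have [a0 hE] := common_constant (scales_by_translation Fc nonconst scale).
pose h p := F p - a0.
have hc : continuous h by move=> p; apply: cvgB; [exact: Fc|exact: cvg_cst].
have h0 : exists p, h p != 0.
  have [p [q pq]] := nonconst; have [hp|?] := eqVneq (h p) 0; last by exists p.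
  exists q; apply/eqP => hq; apply: pq; apply/eqP.
  by rewrite -(inj_eq (addIr (- a0))) -/(h p) -/(h q) hp hq.
have clW : closed [set t : R * R | t.2 = 0].
  rewrite -[X in closed X]/(@snd R R @^-1` [set y | y = 0]).
  by apply: preimage_closed; [move=> x _; exact: cvg_snd|exact: closed_eq].
have [||l l01|v [k [v0 vW hv]]] := @exponential_line _ h _ hc h0 clW.
- by [].
- by move=> x y /= -> ->; rewrite subr0.
- by have [t ht] := hE l l01; exists (t.1, 0).
have v2 : v.2 = 0 by have := vW 1; rewrite scale1r.
have v1 : v.1 != 0 by apply: contra v0 => /eqP v1; case: (v) v1 v2 => x y /= -> ->.
have GE x : G x = a0 + h 0 * expR (k / v.1 * x).
  have -> : k / v.1 * x = k * (x / v.1) by ring.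
  have xE : ((x / v.1) *: v).1 = x by rewrite /= /GRing.scale /= divfK.
  have <- : h (0 + (x / v.1) *: v) = h 0 * expR (k * (x / v.1)) by rewrite hv mulrC.
  by rewrite /h /F add0r xE; ring.
exists a0, (h 0), (k / v.1); split => //.
apply/eqP => kv; apply: nonaff; exists (a0 + h 0), 0 => x.
by rewrite GE kv !mul0r expR0 mulr1 addr0.
Qed.

(** The ratios of the profiles [c * g x / Num.sqrt (1 + (c * m) ^+ 2)] to the
    profile for [c = 1] take all the values in [(0, 1]]. *)
Lemma rigid_cylinder (R : realType) (g : R -> R) (m : R) :
  continuous g -> vertically_rigid (fun p : R * R => g p.1 + m * p.2) ->
  (exists a b : R, forall x, g x = a + b * x) \/
  (exists a b k : R, k != 0 /\ forall x, g x = a + b * expR (k * x)).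
Proof.
move=> gc /vertically_rigidP rig.
have m0 := sqr_ge0 m.
have r0 : 0 < Num.sqrt (1 + m ^+ 2) by rewrite sqrtr_gt0; lra.
set r := Num.sqrt _ in r0.
have rn0 : r != 0 by rewrite gt_eqF.
have [||[a [b gE]]|[a [b [k [k0 gE]]]]] := @rigid_curve R (fun x => g x / r).
- by move=> x; apply: cvgM; [exact: gc|exact: cvg_cst].
- move=> l /andP [l0 l1].
  pose D := 1 + m ^+ 2 * (1 - l ^+ 2).
  have l2 : l ^+ 2 <= 1 by rewrite exprn_ile1// ltW.
  have D1 : 1 <= D by rewrite lerDl mulr_ge0// subr_ge0.
  have D0 : 0 < D by lra.
  have s0 : 0 < Num.sqrt D by rewrite sqrtr_gt0.
  have s2 : Num.sqrt D ^+ 2 = D by rewrite sqr_sqrtr// ltW.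
  (* This [c] solves [c * r = l * Num.sqrt (1 + (c * m) ^+ 2)]. *)
  pose c := l / Num.sqrt D.
  have c0 : 0 < c by rewrite divr_gt0.
  have [A [B [b gA]]] := rig c c0.
  have [J [K gJ]] := cylinder_graph g m.
  have [J' [K' gJ']] := cylinder_graph (fun x => c * g x) (c * m).
  have nu : Num.sqrt (1 + (c * m) ^+ 2) = r / Num.sqrt D.
    have -> : 1 + (c * m) ^+ 2 = (1 + m ^+ 2) / D.
      rewrite exprMn /c expr_div_n s2; apply: (mulIf (negbT (gt_eqF D0))).
      rewrite divfK ?gt_eqF// mulrDl mul1r mulrAC divfK ?gt_eqF// /D; ring.
    have m1 : 0 <= 1 + m ^+ 2 by lra.
    by rewrite (sqrtrM _ m1) (sqrtrV (ltW D0)).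
  have e1 : (fun p : R * R => c * g p.1 / Num.sqrt (1 + (c * m) ^+ 2)) =
      (fun p => l * (g p.1 / r)).
    apply/funext => p; rewrite nu /c; field.
    by rewrite rn0 gt_eqF.
  have e2 : (fun p : R * R => c * (g p.1 + m * p.2)) =
      (fun p => c * g p.1 + c * m * p.2).
    by apply/funext => p; ring.
  rewrite e1 in gJ'; rewrite e2 in gA.
  have gI := graph_isometry_comp (graph_isometry_comp (graph_isometry_sym gJ) gA) gJ'.
  by eexists; eexists; eexists; exact: gI.
- left; exists (r * a), (r * b) => x.
  by have := gE x => /(congr1 (fun y => r * y)); rewrite mulrC divfK// => ->; ring.
- right; exists (r * a), (r * b), k; split => // x.
  by have := gE x => /(congr1 (fun y => r * y)); rewrite mulrC divfK// => ->; ring.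
Qed.

(** A line in the slope cone is a direction of the plane in which [f] is affine
    with a constant slope; once this direction is rotated to the second axis, the
    graph is a cylinder. *)
Lemma rigid_line (R : realType) (f : R * R -> R) w :
  continuous f -> vertically_rigid f -> slope_cone f w -> slope_cone f (- w) ->
  w != 0 ->
  exists theta, affine_form (f \o rotation2 theta) \/
    exp_plus_linear_form (f \o rotation2 theta).
Proof.
move=> fc rig Ew ENw w0; have fw := slope_cone_line Ew ENw.
have v0 : w.1 != 0.
  apply: contra w0 => /eqP v0; have := fw 0 1; rewrite v0 scaler0 addr0 mul1r => s0.
  have {s0} : w.2 = 0 by lra.
  by case: (w) v0 => [v s] /= -> ->.
(* The rotation by [theta] takes the second axis to the direction of [w.1] when
   it takes the first axis to that of the quarter turn [(w.1.2, - w.1.1)]. *)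
have u0 : (w.1.2, - w.1.1) != 0.
  by apply: contra v0; case: (w.1) => x y /eqP [-> /eqP]; rewrite oppr_eq0 => /eqP ->.
have [theta [r [r0 [uc us]]]] := polar u0.
have vE : w.1 = r *: (- sin theta, cos theta).
  by case: (w.1) uc us => x y /= -> /eqP; rewrite eqr_oppLR => /eqP ->; congr pair;
    rewrite /= scalerN.
have fE x y : (f \o rotation2 theta) (x, y) =
    f (rotation2 theta (x, 0)) + w.2 / r * y.
  rewrite /= !rotation2_split scale0r addr0.
  have -> : y *: (- sin theta, cos theta) = (y / r) *: w.1.
    by rewrite vE scalerA divfK// gt_eqF.
  by rewrite fw; ring.
pose g x := f (rotation2 theta (x, 0)).
have gc : continuous g.
  move=> x; apply: (@continuous_comp _ _ _ (fun x : R => rotation2 theta (x, 0)) f);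
    last exact: fc.
  apply: (@continuous_comp _ _ _ (fun x : R => (x, 0)) (rotation2 theta));
    last exact: rotation2_continuous.
  by apply: (@cvg_pair _ _ _ _ (nbhs x) (nbhs (0 : R))); [exact: cvg_id|exact: cvg_cst].
have := @vertically_rigid_rotation _ _ theta rig.
rewrite (_ : f \o _ = (fun p => g p.1 + w.2 / r * p.2)); last by apply/funext => -[x y].
move=> /(rigid_cylinder gc) [[a [b gE]]|[a [b [k [k0 gE]]]]]; exists theta.
- by left; exists a, b, (w.2 / r) => x y; rewrite fE -/(g x) gE.
- by right; exists a, b, (w.2 / r), k; split => // x y; rewrite fE -/(g x) gE.
Qed.

(** * Rigidity of the three forms *)

(** Multiplying by [c] amounts to translating along the first and third axes. *)
Lemma separated_exp_rigid (R : realType) (f : R * R -> R) :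
  separated_exp_form f -> vertically_rigid f.
Proof.
move=> [a [k [s [k0 _ fE]]]]; apply/vertically_rigidP => c c0.
exists id, id, (- (ln c / k), 0, c * a - a); split; first exact: id_isometry.
case=> [[x y] z] /=.
have -> : (x, y) + (- (ln c / k), 0) = (x - ln c / k, y) by congr pair; rewrite /= addr0.
have kE : k * (x - ln c / k) = k * x - ln c by field.
rewrite !fE kE expRD expRN lnK ?posrE//.
have -> : c * (a + s y * (expR (k * x) / c)) = c * a + s y * expR (k * x).
  by field; rewrite gt_eqF.
by split=> h; lra.
Qed.

(** After the cylinders are turned, the profiles [(a + b * expR (k * x)) / r]
    and [c * (a + b * expR (k * x)) / r'] differ by a translation. *)
Lemma exp_plus_linear_rigid (R : realType) (f : R * R -> R) :
  exp_plus_linear_form f -> vertically_rigid f.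
Proof.
move=> [a [b [d [k [k0 fE]]]]]; apply/vertically_rigidP => c c0.
pose u x := a + b * expR (k * x).
have -> : f = (fun p => u p.1 + d * p.2) by apply/funext => -[x y].
have [J [K gJ]] := cylinder_graph u d.
have [J' [K' /graph_isometry_sym gJ']] := cylinder_graph (fun x => c * u x) (c * d).
have pos (x : R) : 0 < Num.sqrt (1 + x ^+ 2).
  by rewrite sqrtr_gt0; have := sqr_ge0 x; lra.
have r0 := pos d; have r0' := pos (c * d).
set r := Num.sqrt _ in r0 gJ; set r' := Num.sqrt _ in r0' gJ'.
pose l := c * r / r'; have l0 : 0 < l by rewrite divr_gt0// mulr_gt0.
have gT : graph_isometry (fun p => u p.1 / r) (fun p => c * u p.1 / r') id id
    (- (ln l / k), 0, c * a / r' - a / r).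
  split; first exact: id_isometry.
  case=> [[x y] z] /=; have kE : k * (x - ln l / k) = k * x - ln l by field.
  rewrite /u kE expRD expRN lnK ?posrE//.
  have -> : c * (a + b * (expR (k * x) / l)) / r' =
      (a + b * expR (k * x)) / r + (c * a / r' - a / r).
    by rewrite /l; field; rewrite !gt_eqF.
  by split=> [->//|/addIr].
have := graph_isometry_comp (graph_isometry_comp gJ gT) gJ'.
rewrite (_ : (fun p => c * u p.1 + c * d * p.2) = (fun p => c * (u p.1 + d * p.2))).
  by move=> g; eexists; eexists; eexists; exact: g.
by apply/funext => p; ring.
Qed.

(** After a further rotation the gradient points along the second axis. *)
Lemma affine_rigid (R : realType) (f : R * R -> R) :
  affine_form f -> vertically_rigid f.
Proof.
move=> [a [b [d fE]]].
have [bd|bd] := eqVneq (d, - b) 0.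
  apply: exp_plus_linear_rigid; exists a, 0, 0, 1; split; first exact: oner_neq0.
  by case: bd => d0 /eqP; rewrite oppr_eq0 => /eqP b0 x y; rewrite fE b0 d0 !mul0r.
have [theta [r [r0 [dc bs]]]] := polar bd.
apply: (@vertically_rigid_unrotation _ _ theta); apply: exp_plus_linear_rigid.
exists a, 0, r, 1; split; first exact: oner_neq0.
move=> x y; rewrite /= fE.
have bE : b = - (r * sin theta) by rewrite -[r * _]bs opprK.
have dE : d = r * cos theta by [].
transitivity (a + r * y * (cos theta ^+ 2 + sin theta ^+ 2)).
  by rewrite bE dE /=; ring.
by rewrite cos2Dsin2; ring.
Qed.

Theorem theorem1p4 (R : realType) (f : R * R -> R) (f_cont : continuous f) :
  vertically_rigid f <->
  exists theta : R,
    [\/ affine_form (f \o rotation2 theta),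
        separated_exp_form (f \o rotation2 theta)
      | exp_plus_linear_form (f \o rotation2 theta)].
Proof.
split=> [rig|[theta [form|form|form]]].
- have [ptE|] := EM (forall w, slope_cone f w -> slope_cone f (- w) -> w = 0).
    have [theta form] := rigid_pointed f_cont rig (slope_cone_pointed f_cont ptE).
    by exists theta; constructor 2.
  move=> /existsNP [w /not_implyP [Ew /not_implyP [ENw /eqP w0]]].
  have [theta [form|form]] := rigid_line f_cont rig Ew ENw w0.
  + by exists theta; constructor 1.
  + by exists theta; constructor 3.
- exact/vertically_rigid_unrotation/affine_rigid/form.
- exact/vertically_rigid_unrotation/separated_exp_rigid/form.
- exact/vertically_rigid_unrotation/exp_plus_linear_rigid/form.
Qed.
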